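(* Let $d\ge 1$ and let $\xi_1,\dots,\xi_d$ be independent centered non-degenerate Gaussian random vectors in $\mathbb{R}^d$ with covariance matrices $\Sigma_1,\dots,\Sigma_d$ respectively. For $i=1,\dots,d$ let $$\mathcal{E}_i=\{\mathbf{x}\in\mathbb{R}^d : \mathbf{x}^\top\Sigma_i^{-1}\mathbf{x}\le 1\}$$ be the location-dispersion ellipsoid of $\xi_i$, and let $M$ be the $d\times d$ random matrix whose rows are $\xi_1,\dots,\xi_d$. Then $$\mathbb{E}\,|\det M|=\frac{d!}{(2\pi)^{d/2}}\,V_d(\mathcal{E}_1,\dots,\mathcal{E}_d),$$ where $V_d(\cdot,\dots,\cdot)$ is the mixed volume of $d$ convex bodies in $\mathbb{R}^d$.
   Context: A centered Gaussian vector is non-degenerate if its covariance matrix is invertible (symmetric positive definite). Mixed volume: for convex bodies $K_1,\dots,K_d\subset\mathbb{R}^d$, the function $(\lambda_1,\dots,\lambda_d)\mapsto \mathrm{Vol}_d(\lambda_1K_1+\dots+\lambda_dK_d)$ (Minkowski sums, $\lambda_i\ge 0$) is a homogeneous polynomial of degree $d$, written $$\mathrm{Vol}_d(\lambda_1K_1+\dots+\lambda_dK_d)=\sum_{i_1=1}^d\cdots\sum_{i_d=1}^d\lambda_{i_1}\cdots\lambda_{i_d}V_d(K_{i_1},\dots,K_{i_d})$$ with coefficients symmetric under permutations of $K_{i_1},\dots,K_{i_d}$. The number $V_d(K_1,\dots,K_d)$ is the mixed volume; equivalently, $V_d(K_1,\dots,K_d)=\frac{1}{d!}\frac{\partial^d}{\partial\lambda_1\cdots\partial\lambda_d}$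 of this polynomial at $\lambda_1=\dots=\lambda_d=0$. In particular $V_d(K,\dots,K)=\mathrm{Vol}_d(K)$. *)

(* Defs.v *)
From HB Require Import structures.
From mathcomp Require Import all_boot all_order all_algebra all_fingroup.
From mathcomp Require Import all_classical all_reals all_analysis.

Set Implicit Arguments.
Unset Strict Implicit.
Unset Printing Implicit Defensive.

Import Order.TTheory GRing.Theory Num.Theory.
Import numFieldNormedType.Exports.

Local Open Scope classical_set_scope.
Local Open Scope ring_scope.

(* Random vectors in R^n take values in [n.-tuple R], which carries the product
   (Borel) sigma-algebra; linear algebra and convex geometry use ['rV[R]_n]. *)
Definition row_of_tuple (R : realType) (n : nat) (t : n.-tuple R) : 'rV[R]_n :=
  \row_j tnth t j.

Definition mutually_independent (disp disp' : measure_display)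
    (Omega : measurableType disp) (T : measurableType disp') (R : realType)
    (P : probability Omega R) (I : finType) (X : I -> {RV P >-> T}) : Prop :=
  forall (J : {set I}) (B : I -> set T), (forall i, measurable (B i)) ->
    (P (\bigcap_(i in [set` J]) X i @^-1` B i) =
     \prod_(i in J) P (X i @^-1` B i))%E.

(* [normal_prob m 0] is the uniform law on [0, 1], so the degenerate normal law
   has to be supplied separately. *)
Definition gaussian_law (R : realType) (m s : R) (A : set R) : \bar R :=
  if s == 0 then \d_m A else normal_prob m s A.

Definition gaussian_vector (disp : measure_display)
    (Omega : measurableType disp) (R : realType) (P : probability Omega R)
    (n : nat) (X : {RV P >-> n.-tuple R}) : Prop :=
  forall u : n.-tuple R, exists m s : R, forall A : set R, measurable A ->
    P [set w | A (\sum_j tnth u j * tnth (X w) j)] = gaussian_law m s A.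

Definition centered_vector (disp : measure_display)
    (Omega : measurableType disp) (R : realType) (P : probability Omega R)
    (n : nat) (X : {RV P >-> n.-tuple R}) : Prop :=
  forall j, ('E_P[fun w => tnth (X w) j] = 0)%E.

Definition has_covariance_matrix (disp : measure_display)
    (Omega : measurableType disp) (R : realType) (P : probability Omega R)
    (n : nat) (X : {RV P >-> n.-tuple R}) (S : 'M[R]_n) : Prop :=
  forall j k,
    covariance P (fun w => tnth (X w) j) (fun w => tnth (X w) k) = (S j k)%:E.

(* n-dimensional Lebesgue measure as the n-fold product of the one on R. *)
Fixpoint lebesgue_tuple (R : realType) (n : nat) : set (n.-tuple R) -> \bar R :=
  match n with
  | 0 => \d_[tuple]
  | n'.+1 => pushforward (@lebesgue_measure R \x @lebesgue_tuple R n')%E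
               (fun p : R * n'.-tuple R => [tuple of p.1 :: p.2])
  end.

Definition Vol (R : realType) (n : nat) (A : set 'rV[R]_n) : \bar R :=
  lebesgue_tuple (@row_of_tuple R n @^-1` A).

Definition minkowski_comb (R : realType) (n : nat) (I : finType)
    (lam : I -> R) (K : I -> set 'rV[R]_n) : set 'rV[R]_n :=
  [set \sum_i lam i *: x i | x in [set x : I -> 'rV[R]_n | forall i, K i (x i)]].

(* [V f] is the symmetric coefficient V_n(K_(f 1), ..., K_(f n)) of
   lam_(f 1) ... lam_(f n) in the volume polynomial. *)
Definition mixed_volume_coefs (R : realType) (n : nat)
    (K : 'I_n -> set 'rV[R]_n) (V : {ffun 'I_n -> 'I_n} -> R) : Prop :=
  (forall (s : 'S_n) (f : {ffun 'I_n -> 'I_n}), V [ffun k => f (s k)] = V f) /\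
  (forall lam : 'I_n -> R, (forall i, 0 <= lam i) ->
     Vol (minkowski_comb lam K) =
     (\sum_(f : {ffun 'I_n -> 'I_n}) (\prod_k lam (f k)) * V f)%:E).

(* The coefficients exist and are unique when the [K i] are convex bodies; the
   value 0 is a default for families without such coefficients. *)
Definition mixed_volume (R : realType) (n : nat)
    (K : 'I_n -> set 'rV[R]_n) : R :=
  xget 0 [set v | exists2 V, mixed_volume_coefs K V & v = V [ffun i => i]].

(* Points are row vectors, so x^T S^-1 x reads [x *m invmx S *m x^T]. *)
Definition ellipsoid (R : realType) (n : nat) (S : 'M[R]_n) : set 'rV[R]_n :=
  [set x | (x *m invmx S *m x^T) 0 0 <= 1].

(* Main.v *)
(** Up to the factor [sqrt (pi / 2)], the support function
    [u |-> sqrt (u S u^T)] of an ellipsoid is the mean of [|<u, xi>|], so the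
    ellipsoid is a zonoid.  Replacing each [xi_i] by a vector with finitely
    many values turns [E_i] into a zonotope [Z_i] with
    [(1 - e) E_i <= Z_i <= (1 + e) E_i]: one inclusion is a Cauchy-Schwarz
    estimate, the other one needs a separating hyperplane.

    The volume of a zonotope [sum_k [-1, 1] v_k] in dimension [d] is
    [2 ^ d / d!] times the sum of the [|det|] over all [d]-tuples of the
    [v_k]: adding [[-1, 1] a] to a convex body [A] adds to its volume
    [2 |a_j|] times the volume of the projection of [A] along [a], and the
    determinants satisfy the same recursion.  Hence
    [Vol (sum_i lam_i Z_i)] is a polynomial in [lam] whose mixed coefficient
    is, by independence, [(2 pi) ^ (d / 2) / d!] times the mean [|det|] of the
    discretised vectors.

    As [e] tends to 0 these polynomials converge pointwise.  Polarisation
    writes the symmetric coefficients as finite signed sums of values of the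
    polynomial, so the coefficients converge too and are unique. *)
Require Import Defs.
From HB Require Import structures.
From mathcomp Require Import all_boot all_order all_algebra all_fingroup.
From mathcomp Require Import all_classical all_reals all_analysis.
From mathcomp Require Import measurable_realfun normal_distribution.
From mathcomp Require Import ring lra zify.

Set Implicit Arguments.
Unset Strict Implicit.
Unset Printing Implicit Defensive.

Import Order.TTheory GRing.Theory Num.Theory.
Import numFieldNormedType.Exports.

Local Open Scope classical_set_scope.
Local Open Scope ring_scope.

(** * Lebesgue measure on rows *)

(** [mixed_volume] is a default value unless the volume polynomial has symmetric coefficients, so
    their existence for ellipsoids has to be proved. It is obtained here as a limit from zonotopes,
    whose coefficients are explicit. The discretisation turns both sides into finite sums over the
    same index set. A value [x] taken with probability [p] by the discretised [xi_i] contributes the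
    segment [[-1, 1] kappa p x], where [kappa = sqrt (pi / 2)]. A determinant of such generators
    carries a product of probabilities, which by independence is a joint probability. The length 2
    of [[-1, 1]] and the factor [kappa] combine into [(2 kappa) ^ d = (2 pi) ^ (d / 2)]. The
    Gaussian law enters only through second and absolute moments of the linear forms [<u, xi_i>].
    Invertibility of the covariance makes the L1 error of the discretised [<u, xi_i>] small relative
    to [sqrt (u S u^T)], uniformly in [u]; this is what gives multiplicative factors [1 - e] and
    [1 + e]. *)

Section sigma_finite_copy.
Context (d : measure_display) (T : measurableType d) (R : realType)
  (nu : {measure set T -> \bar R}) (nu_sf : sigma_finite setT nu).

(* An alias on which to hang the sigma-finite structure: the measure structure
   of [pushforward] depends on a measurability proof. *)
Definition sigma_finite_copy of sigma_finite setT nu : set T -> \bar R := nu.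

HB.instance Definition _ := Measure.copy (sigma_finite_copy nu_sf) nu.

HB.instance Definition _ := Measure_isSigmaFinite.Build _ _ _
  (sigma_finite_copy nu_sf) nu_sf.

End sigma_finite_copy.

Section lebesgue_tuple_theory.
Context {R : realType}.
Notation mu := (@lebesgue_measure R).

(* No measurability: the integral is a supremum over simple minorants.  This
   spares us the measurability of Minkowski sums. *)
Lemma ge0_le_integral_nomeas (disp : measure_display) (T : measurableType disp)
    (m : {measure set T -> \bar R}) (f g : T -> \bar R) :
  (forall x, 0 <= f x)%E -> (forall x, f x <= g x)%E ->
  (\int[m]_x f x <= \int[m]_x g x)%E.
Proof.
move=> f0 fg.
have g0 x : (0 <= g x)%E by exact: le_trans (f0 x) (fg x).
rewrite !ge0_integralTE//; apply: ge_ereal_sup => _ [h /= hf <-].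
by apply: ereal_sup_ubound; exists h => //= x; exact: le_trans (hf x) (fg x).
Qed.

Lemma lebesgue_tuple_ge0 n (A : set (n.-tuple R)) : (0 <= lebesgue_tuple A)%E.
Proof.
elim: n A => [|n IH] A /=; first by rewrite diracE.
by apply: integral_ge0 => x _ /=.
Qed.

Lemma lebesgue_tuple_le n (A B : set (n.-tuple R)) :
  A `<=` B -> (lebesgue_tuple A <= lebesgue_tuple B)%E.
Proof.
elim: n A B => [|n IH] A B AB.
  rewrite /= !diracE lee_fin ler_nat.
  by case: (boolP (_ \in A)) => //; rewrite inE => /AB; rewrite -inE => ->.
rewrite /= /pushforward /product_measure1.
apply: ge0_le_integral_nomeas => x /=; first exact: lebesgue_tuple_ge0.
by apply: IH => y; rewrite /xsection/= !inE/=; exact: AB.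
Qed.


Lemma product_sigma_finite (d1 d2 : measure_display) (T1 : measurableType d1)
    (T2 : measurableType d2) (m1 : {sigma_finite_measure set T1 -> \bar R})
    (m2 : {sigma_finite_measure set T2 -> \bar R}) :
  sigma_finite setT (m1 \x m2)%E.
Proof.
have /sigma_finiteP[F [TF ndF Foo]] := sigma_finiteT m1.
have /sigma_finiteP[G [TG ndG Goo]] := sigma_finiteT m2.
exists (fun n => F n `*` G n).
  apply/seteqP; split=> // -[x y] _.
  have [i _ Fix] : (\bigcup_i F i) x by rewrite -TF.
  have [j _ Gjy] : (\bigcup_i G i) y by rewrite -TG.
  exists (maxn i j) => //; split=> /=.
    by have /subsetPset := ndF _ _ (leq_maxl i j); apply.
  by have /subsetPset := ndG _ _ (leq_maxr i j); apply.
move=> k; have [? ?] := Foo k; have [? ?] := Goo k.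
split; first exact: measurableX.
by rewrite product_measure1E// lte_mul_pinfty// ge0_fin_numE.
Qed.

Lemma measurable_tuple_cons n :
  measurable_fun setT (fun p : measurableTypeR R * n.-tuple R =>
    [tuple of p.1 :: p.2] : n.+1.-tuple R).
Proof.
apply: (@measurable_cons _ _ (measurableTypeR R * n.-tuple R)%type R
  (fun p => p.1 : R) n snd); [exact: measurable_fst|exact: measurable_snd].
Qed.

(** Tonelli needs a sigma-finite measure, whereas [lebesgue_tuple] is a bare set function defined by
    recursion. Prepending a coordinate is a bijection with measurable inverse, so sigma-finiteness
    of the product passes to its pushforward. *)
Lemma lebesgue_tuple_sigma_finite n :
  exists m : {sigma_finite_measure set (n.-tuple R) -> \bar R},
    forall A, m A = lebesgue_tuple A.
Proof.
elim: n => [|n [m mE]].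
  by exists (@dirac _ (0.-tuple R) [tuple] R).
pose f (p : measurableTypeR R * n.-tuple R) : n.+1.-tuple R :=
  [tuple of p.1 :: p.2].
have mf : measurable_fun setT f by exact: measurable_tuple_cons.
pose g (t : n.+1.-tuple R) : measurableTypeR R * n.-tuple R :=
  (thead t, [tuple of behead t]).
have mg : measurable_fun setT g.
  apply/measurable_fun_pair; first exact: (@measurable_tnth _ R).
  exact: (@measurable_behead _ R).
have gf : cancel f g.
  by case=> x t; rewrite /f /g theadE; congr pair; apply/val_inj.
have fg : cancel g f.
  by move=> t; apply/val_inj; rewrite [t in RHS]tuple_eta.
have m'E : forall A, pushforward (mu \x m)%E f A = lebesgue_tuple A.
  move=> A; rewrite /= /pushforward /product_measure1.
  by apply: eq_integral => x _ /=; rewrite mE.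
have sf : sigma_finite setT (pushforward (mu \x m)%E f).
  have [F UF Foo] := product_sigma_finite mu m.
  exists (fun n => g @^-1` F n).
    by rewrite -preimage_bigcup -UF.
  move=> i; have [mF Fioo] := Foo i; split.
    by rewrite -[_ @^-1` _]setTI; exact: mg.
  rewrite /pushforward; congr (_ < _)%E: Fioo; congr (product_measure1 _ _ _).
  by apply/seteqP; split=> p /=; rewrite gf.
pose nu : {measure set (n.+1.-tuple R) -> \bar R} :=
  measure_function_pushforward__canonical__measure_function_Measure
    (mu \x m)%E mf.
by exists (@sigma_finite_copy _ _ _ nu sf) => A; rewrite -m'E.
Qed.

End lebesgue_tuple_theory.

(** * Slices, fibers and the order of integration *)

Section slices.
Context {R : realType}.
Notation mu := (@lebesgue_measure R).

Definition cons_row n (x : R) (y : 'rV[R]_n) : 'rV[R]_n.+1 :=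
  \row_j oapp (y 0) x (unlift ord0 j).

Lemma cons_row0 n x (y : 'rV[R]_n) : cons_row x y 0 ord0 = x.
Proof. by rewrite mxE unlift_none. Qed.

Lemma cons_rowS n x (y : 'rV[R]_n) k : cons_row x y 0 (lift ord0 k) = y 0 k.
Proof. by rewrite mxE liftK. Qed.

Lemma cons_rowP n (z z' : 'rV[R]_n.+1) : z 0 ord0 = z' 0 ord0 ->
  (forall k, z 0 (lift ord0 k) = z' 0 (lift ord0 k)) -> z = z'.
Proof.
move=> z0 zS; apply/rowP => j.
by case: (unliftP ord0 j) => [k|] ->.
Qed.

Lemma cons_row_col' n (z : 'rV[R]_n.+1) :
  cons_row (z 0 ord0) (col' ord0 z) = z.
Proof.
by apply: cons_rowP => [|k]; rewrite ?cons_row0// cons_rowS mxE.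
Qed.

Lemma col'_cons_row n x (y : 'rV[R]_n) : col' ord0 (cons_row x y) = y.
Proof. by apply/rowP => k; rewrite mxE cons_rowS. Qed.

Lemma row_of_tuple_cons n x (t : n.-tuple R) :
  row_of_tuple [tuple of x :: t] = cons_row x (row_of_tuple t).
Proof.
by apply: cons_rowP => [|k]; rewrite ?cons_row0 ?cons_rowS !mxE ?tnthS.
Qed.

Definition tuple_of_row n (y : 'rV[R]_n) : n.-tuple R := [tuple y 0 i | i < n].

Definition slice n (A : set 'rV[R]_n.+1) (x : R) : set 'rV[R]_n :=
  [set y | A (cons_row x y)].

(** Cavalieri's principle for arbitrary sets: [lebesgue_tuple] is by definition an iterated integral
    with the first coordinate outermost. *)
Lemma Vol_slice n (A : set 'rV[R]_n.+1) :
  (Vol A = \int[mu]_x Vol (slice A x))%E.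
Proof.
rewrite /Vol /= /pushforward /product_measure1.
apply: eq_integral => x _ /=; congr (lebesgue_tuple _).
by apply/seteqP; split=> t; rewrite /xsection/= ?inE/= row_of_tuple_cons.
Qed.

Lemma Vol_dim0 (A : set 'rV[R]_0) : A 0 -> Vol A = 1%E.
Proof.
move=> A0; rewrite /Vol/= diracE mem_set//=.
by rewrite (_ : row_of_tuple _ = 0)//; apply/rowP => -[].
Qed.

Lemma Vol_le n (A B : set 'rV[R]_n) : A `<=` B -> (Vol A <= Vol B)%E.
Proof. by move=> AB; apply: lebesgue_tuple_le => t /=; exact: AB. Qed.

Lemma Vol_ge0 n (A : set 'rV[R]_n) : (0 <= Vol A)%E.
Proof. exact: lebesgue_tuple_ge0. Qed.

Definition row_measurable n (A : set 'rV[R]_n) : Prop :=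
  measurable (@row_of_tuple R n @^-1` A).

Lemma row_measurable_pair n (A : set 'rV[R]_n.+1) : row_measurable A ->
  measurable [set p : measurableTypeR R * n.-tuple R |
    A (cons_row p.1 (row_of_tuple p.2))].
Proof.
move=> mA; have := measurable_tuple_cons (n := n) measurableT mA.
rewrite setTI; congr measurable; apply/seteqP.
by split=> p /=; rewrite row_of_tuple_cons.
Qed.

Lemma measurable_Vol_slice n (A : set 'rV[R]_n.+1) : row_measurable A ->
  measurable_fun [set: R] (fun x => Vol (slice A x) : \bar R).
Proof.
move=> /row_measurable_pair mA.
have [m mE] := @lebesgue_tuple_sigma_finite R n.
have := measurable_fun_xsection m mA; congr (measurable_fun _ _).
apply/funext => x /=; rewrite mE; congr lebesgue_tuple.
by apply/seteqP; split=> t; rewrite /xsection/= inE.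
Qed.

(** The opposite order of integration: the inner integral runs along lines parallel to the first
    axis, the direction in which segments will be added. *)
Lemma Vol_fiber n (m : {sigma_finite_measure set (n.-tuple R) -> \bar R})
    (A : set 'rV[R]_n.+1) :
  (forall B, m B = lebesgue_tuple B) -> row_measurable A ->
  measurable_fun setT (fun t => mu [set x | A (cons_row x (row_of_tuple t))]) /\
  (Vol A = \int[m]_t mu [set x | A (cons_row x (row_of_tuple t))])%E.
Proof.
move=> mE mA.
have mA' := row_measurable_pair mA.
have sE t : mu (ysection [set p : measurableTypeR R * n.-tuple R |
    A (cons_row p.1 (row_of_tuple p.2))] t) =
    mu [set x | A (cons_row x (row_of_tuple t))].
  by congr mu; apply/seteqP; split=> x; rewrite /ysection/= inE.
split.
  have := measurable_fun_ysection mu mA'; congr measurable_fun.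
  by apply/funext => t /=; rewrite sE.
rewrite Vol_slice; transitivity ((mu \x m)%E [set p : measurableTypeR R * n.-tuple R |
    A (cons_row p.1 (row_of_tuple p.2))]).
  apply: eq_integral => x _ /=; rewrite mE; congr (lebesgue_tuple _).
  by apply/seteqP; split=> t; rewrite /xsection/= ?inE.
(* Both iterated integrals are measures with the same values on rectangles, hence they coincide. *)
rewrite (@product_measure_unique _ _ _ _ _ mu m (mu \x^ m)%E)//; last first.
  by move=> B C mB mC; exact: product_measure2E.
by apply: eq_integral => t _ /=; rewrite sE.
Qed.

End slices.

(** * Invariance under translations and shears *)

Section translation.
Context {R : realType}.
Notation mu := (@lebesgue_measure R).

Lemma measurable_addr (c : R) : measurable_fun [set: R] (fun x : R => x + c).
Proof. exact: measurable_funD. Qed.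

Lemma lebesgue_measureD (c : R) (A : set R) : measurable A ->
  mu [set x | A (x + c)] = mu A.
Proof.
move=> mA; rewrite -[LHS]/(pushforward mu (+%R^~ c : _ -> measurableTypeR R) A).
apply/esym/lebesgue_measure_unique => //= [|_ _ [[a b]] _ <-].
  exact: measurable_addr.
rewrite /pushforward (_ : _ @^-1` _ = `]a - c, b - c]%classic); last first.
  by apply/seteqP; split=> x /=; rewrite !in_itv/= ltrBlDr lerBrDr.
rewrite !lebesgue_measure_itv/= !lte_fin ltrD2r.
by case: ifP => // _; rewrite -!EFinB; congr (_%:E); ring.
Qed.

Lemma ge0_integral_shift (c : R) (f : R -> \bar R) :
  measurable_fun [set: R] f -> (forall x, 0 <= f x)%E ->
  (\int[mu]_x f (x + c)%R = \int[mu]_x f x)%E.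
Proof.
move=> mf f0.
transitivity (\int[pushforward mu (+%R^~ c : _ -> measurableTypeR R)]_x f x)%E.
  rewrite ge0_integral_pushforward//=.
  exact: measurable_addr.
apply: eq_measure_integral => //= [|_ A mA _].
  exact: measurable_addr.
exact: lebesgue_measureD.
Qed.

Lemma row_measurable_slice n (A : set 'rV[R]_n.+1) x :
  row_measurable A -> row_measurable (slice A x).
Proof.
move=> /row_measurable_pair /(measurable_xsection x).
congr measurable.
by apply/seteqP; split=> t; rewrite /xsection/= ?inE.
Qed.

Lemma Vol_translate n (A : set 'rV[R]_n) (v : 'rV[R]_n) :
  row_measurable A -> Vol [set y | A (y + v)] = Vol A.
Proof.
elim: n A v => [|n IH] A v mA.
  by congr Vol; apply/seteqP; split=> y /=; rewrite (_ : y + v = y)//;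
    apply/rowP => -[].
rewrite !Vol_slice.
rewrite -(ge0_integral_shift (v 0 ord0) (f := fun x => Vol (slice A x))); first last.
- by move=> x; exact: Vol_ge0.
- exact: measurable_Vol_slice.
apply: eq_integral => x _.
rewrite -[RHS](IH _ (col' ord0 v)); last exact: row_measurable_slice.
congr Vol.
apply/funext => y; rewrite /slice /=; congr A.
by apply: cons_rowP => [|k]; rewrite mxE ?cons_row0 ?cons_rowS // !mxE.
Qed.

(* The shear translates each slice. *)
Lemma Vol_shear n (A : set 'rV[R]_n.+1) (w : 'rV[R]_n) :
  row_measurable A -> Vol [set z : 'rV[R]_n.+1 | A (z + z 0 ord0 *: cons_row 0 w)] = Vol A.
Proof.
move=> mA; rewrite !Vol_slice; apply: eq_integral => x _.
rewrite -[RHS](Vol_translate (x *: w)); last exact: row_measurable_slice.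
congr Vol; apply/funext => y; rewrite /slice /= cons_row0; congr A.
apply: cons_rowP => [|k]; rewrite !mxE ?unlift_none ?liftK/=.
  by rewrite mulr0 addr0.
by rewrite !mxE.
Qed.

End translation.

Section row_topology.
Context {R : realType}.

Lemma row_continuous (T : topologicalType) n (f : T -> 'rV[R]_n) :
  (forall j, continuous (fun x => f x 0 j)) -> continuous f.
Proof.
move=> cf x; apply/cvg_ballP => e e0.
have h j : \forall y \near x, ball (f x 0 j) e (f y 0 j).
  by have /cvg_ballP := cf j x; exact.
have H : \forall y \near x, forall j, ball (f x 0 j) e (f y 0 j).
  exact: filter_forall.
by apply: filterS H => y fxy; split=> // i j; rewrite (ord1 i).
Qed.

(** Rows carry a topology, tuples a product sigma-algebra. Boxes with rational corners link the two:
    they are measurable, countably many, and those that miss [A] cover its complement. *)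
Lemma closed_row_measurable n (A : set 'rV[R]_n) : closed A -> row_measurable A.
Proof.
move=> cA.
pose box (pq : {ffun 'I_n -> rat * rat}) : set 'rV[R]_n :=
  [set z | forall j, ratr (pq j).1 < z 0 j < ratr (pq j).2].
have mbox pq : measurable (@row_of_tuple R n @^-1` box pq).
  rewrite (_ : _ @^-1` _ = \bigcap_(j in [set: 'I_n])
    ((@tnth n R)^~ j @^-1` `]ratr (pq j).1, ratr (pq j).2[%classic)).
    apply: fin_bigcap_measurable => // j _; rewrite -[_ @^-1` _]setTI.
    by apply: (@measurable_tnth _ R) => //; exact: measurable_itv.
  apply/seteqP; split=> t tb j.
    by move=> _; have := tb j; rewrite /= mxE in_itv.
  by have := tb j I; rewrite /= in_itv/= mxE.
rewrite /row_measurable; suff -> : @row_of_tuple R n @^-1` A = ~` (\bigcup_pq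
    (if pselect (box pq `&` A = set0) then @row_of_tuple R n @^-1` box pq
     else set0)).
  apply: measurableC; apply: countable_bigcupT_measurable.
    exact: countableP.
  by move=> pq; case: pselect => ?; [exact: mbox|exact: measurable0].
apply/seteqP; split=> t /=.
  move=> At [pq _]; case: pselect => // pA tb.
  by have : (box pq `&` A) (row_of_tuple t) by []; rewrite pA.
apply: contra_notP => nAt.
have oA : open (~` A) by exact: closed_openC.
have /nbhs_ballP[e /= e0 eA] : nbhs (row_of_tuple t) (~` A).
  exact: open_nbhs_nbhs.
have /choice[p hp] : forall j, exists q : rat,
    ratr q \in `](row_of_tuple t) 0 j - e, (row_of_tuple t) 0 j[.
  by move=> j; apply: rat_in_itvoo; rewrite ltrBlDr ltrDl.
have /choice[q hq] : forall j, exists q : rat,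
    ratr q \in `](row_of_tuple t) 0 j, (row_of_tuple t) 0 j + e[.
  by move=> j; apply: rat_in_itvoo; rewrite ltrDl.
exists [ffun j => (p j, q j)] => //; case: pselect => /= [_ j|].
  rewrite ffunE/=; have := hp j; have := hq j; rewrite !in_itv/=.
  by move=> /andP[-> _] /andP[_ ->].
case; apply/seteqP; split=> // z [zb Az]; apply: (eA z) => //.
split=> // i j; rewrite (ord1 i) /ball/= ltr_distlC.
have := hp j; have := hq j; have := zb j; rewrite ffunE/= !in_itv/=.
move=> /andP[h1 h2] /andP[h3 h4] /andP[h5 h6].
by rewrite (lt_trans h5 h1) (lt_trans h2 h4).
Qed.

Lemma compact_row_measurable n (A : set 'rV[R]_n) :
  compact A -> row_measurable A.
Proof.
by move=> cA; apply: closed_row_measurable; apply: compact_closed.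
Qed.

End row_topology.

Section continuous_arith.
Context {R : realType} (T : topologicalType).
Implicit Types f g : T -> R.

Lemma continuous_add f g :
  continuous f -> continuous g -> continuous (fun x => f x + g x).
Proof. by move=> cf cg x; apply: cvgD; [exact: cf|exact: cg]. Qed.

Lemma continuous_sub f g :
  continuous f -> continuous g -> continuous (fun x => f x - g x).
Proof. by move=> cf cg x; apply: cvgB; [exact: cf|exact: cg]. Qed.

Lemma continuous_mul f g :
  continuous f -> continuous g -> continuous (fun x => f x * g x).
Proof. by move=> cf cg x; apply: cvgM; [exact: cf|exact: cg]. Qed.

End continuous_arith.

(** * Adding a segment to a convex body *)

Section segment_sum.
Context {R : realType}.
Notation mu := (@lebesgue_measure R).

Definition convex_rows n (A : set 'rV[R]_n) : Prop :=
  forall x y t, A x -> A y -> 0 <= t <= 1 -> A (t *: x + (1 - t) *: y).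

(* [A + [-1, 1] a]. *)
Definition segment_sum n (A : set 'rV[R]_n) (a : 'rV[R]_n) : set 'rV[R]_n :=
  [set z | exists2 t, -1 <= t <= 1 & A (z - t *: a)].

(* Projection along [a] onto the hyperplane [z_j = 0], whose null coordinate is
   then dropped. *)
Definition project_along n (j : 'I_n.+1) (a z : 'rV[R]_n.+1) : 'rV[R]_n :=
  col' j (z - (z 0 j / a 0 j) *: a).

Lemma project_along_continuous n j (a : 'rV[R]_n.+1) :
  continuous (project_along j a).
Proof.
apply: row_continuous => k.
rewrite (_ : (fun z => _) = (fun z : 'rV[R]_n.+1 =>
   z 0 (lift j k) - z 0 j * ((a 0 j)^-1 * a 0 (lift j k)))); last first.
  by apply/funext => z; rewrite !mxE mulrA.
apply: continuous_sub; first exact: coord_continuous.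
by apply: continuous_mul; [exact: coord_continuous|exact: cst_continuous].
Qed.

Lemma compact_image (T U : topologicalType) (f : T -> U) (A : set T) :
  continuous f -> compact A -> compact (f @` A).
Proof.
by move=> cf; apply: continuous_compact; exact: continuous_subspaceT.
Qed.

Lemma segment_sum_compact n (A : set 'rV[R]_n) a :
  compact A -> compact (segment_sum A a).
Proof.
move=> cA; pose f (p : 'rV[R]_n * R) := p.1 + p.2 *: a.
have -> : segment_sum A a = f @` (A `*` `[-1, 1]%classic).
  apply/seteqP; split=> z.
    move=> [t t1 At]; exists (z - t *: a, t); last by rewrite /f/= subrK.
    by split=> //=; rewrite in_itv.
  move=> [[x t] /= [Ax]]; rewrite in_itv/= => t1 <-; exists t => //.
  by rewrite /f/= addrK.
apply: compact_image; last by apply: compact_setX => //; exact: segment_compact.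
apply: row_continuous => j.
rewrite (_ : (fun x => _) = (fun p : 'rV[R]_n * R => p.1 0 j + p.2 * a 0 j)).
  apply: continuous_add => [p|].
    apply: (@continuous_comp _ _ _ fst (fun M : 'rV[R]_n => M 0 j)).
      exact: cvg_fst.
    exact: coord_continuous.
  by apply: continuous_mul => [p|]; [exact: cvg_snd|exact: cst_continuous].
by apply/funext => q; rewrite !mxE.
Qed.

Lemma segment_sum_convex n (A : set 'rV[R]_n) a :
  convex_rows A -> convex_rows (segment_sum A a).
Proof.
move=> cA x y t [s /andP[s0 s1] Ax] [r /andP[r0 r1] Ay] /andP[t0 t1].
exists (t * s + (1 - t) * r); first by nra.
rewrite (_ : _ - _ = t *: (x - s *: a) + (1 - t) *: (y - r *: a)).
  by apply: cA => //; rewrite t0.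
by apply/rowP => j; rewrite !mxE; ring.
Qed.

Lemma slice_convex n (A : set 'rV[R]_n.+1) x :
  convex_rows A -> convex_rows (slice A x).
Proof.
move=> cA y z t Ay Az t01; rewrite /slice/=.
rewrite (_ : cons_row _ _ = t *: cons_row x y + (1 - t) *: cons_row x z).
  exact: cA.
apply: cons_rowP => [|k]; rewrite !mxE ?unlift_none ?liftK/= ?mxE//.
by ring.
Qed.

Lemma slice_compact n (A : set 'rV[R]_n.+1) x : compact A -> compact (slice A x).
Proof.
move=> cA; rewrite (_ : slice A x =
   col' ord0 @` (A `&` [set z : 'rV[R]_n.+1 | z 0 ord0 = x])).
  apply: compact_image.
    apply: row_continuous => j z; rewrite (_ : (fun x => _) =
      (fun x : 'rV[R]_n.+1 => x 0 (lift ord0 j))); first exact: coord_continuous.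
    by apply/funext => y; rewrite mxE.
  apply: compact_closedI => //.
  apply: (@closed_comp _ _ (fun z : 'rV[R]_n.+1 => z 0 ord0) [set x]).
    by move=> z _; exact: coord_continuous.
  exact: closed_eq.
apply/seteqP; split=> [y Ay|_ [z [Az <-] <-]].
  exists (cons_row x y); last exact: col'_cons_row.
  by split=> //=; rewrite cons_row0.
by rewrite /slice/= cons_row_col'.
Qed.

(** [F] is the segment from its minimum [p] to its maximum [q], and the sum is [[p - |c|, q + |c|]].
    Nonemptiness matters: for empty [F] the left side is 0. *)
Lemma compact_interval_sum (F : set R) (c : R) : F !=set0 -> compact F ->
  (forall x y t, F x -> F y -> 0 <= t <= 1 -> F (t * x + (1 - t) * y)) ->
  mu [set x | exists2 t, -1 <= t <= 1 & F (x - t * c)] =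
  (mu F + (2 * `|c|)%:E)%E.
Proof.
move=> FF cF vF.
have cid : {within F, continuous (fun x : R => x)}.
  by apply: continuous_subspaceT => x; exact: cvg_id.
have [p /[!inE] Fp pmin] := compact_EVT_min FF cF cid.
have [q /[!inE] Fq qmax] := compact_EVT_max FF cF cid.
have pq : p <= q by apply: pmin; rewrite inE.
have FE : F = `[p, q]%classic.
  apply/seteqP; split=> x /=.
    by move=> Fx; rewrite in_itv/= pmin ?inE// qmax ?inE.
  rewrite in_itv/= => /andP[px xq]; have [pq'|pq'] := eqVneq p q.
    by rewrite (_ : x = p)//; apply/eqP; rewrite eq_le px pq' xq.
  have qp : 0 < q - p by rewrite subr_gt0 lt_neqAle pq'.
  rewrite (_ : x = ((q - x) / (q - p)) * p + (1 - (q - x) / (q - p)) * q).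
    apply: vF => //; apply/andP; split.
      by rewrite divr_ge0 ?subr_ge0// ltW.
    by rewrite ler_pdivrMr// mul1r lerD2l lerN2.
  by field; rewrite gt_eqF.
rewrite (_ : [set x | _] = `[p - `|c|, q + `|c|]%classic).
  rewrite FE !lebesgue_measure_itv/= !lte_fin.
  have c0 : 0 <= `|c| by [].
  case: ifPn => h1; case: ifPn => h2; rewrite ?add0e.
  - by rewrite -!EFinB -EFinD; congr (_%:E); ring.
  - by rewrite -!EFinB; congr (_%:E); lra.
  - by exfalso; move: h1; rewrite -leNgt; lra.
  - by congr (_%:E); move: h1; rewrite -leNgt; lra.
rewrite FE; apply/seteqP; split=> x /=.
  move=> [t t1]; rewrite !in_itv/= => /andP[h1 h2].
  have : `|t * c| <= `|c|.
    by rewrite normrM ler_piMl// ler_norml.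
  by rewrite ler_norml => /andP[h3 h4]; apply/andP; split; lra.
rewrite in_itv/= => /andP[h1 h2].
(* Points left of [p] are reached from [p], points right of [q] from [q], and those in between with
   [t = 0]. *)
have [cx|xp] := leP p x; last first.
  have c0 : c != 0.
    by apply/eqP => c0; move: h1; rewrite c0 normr0; lra.
  exists ((x - p) / c); last by rewrite divfK// in_itv/=; lra.
  rewrite -ler_norml normrM normfV ler_pdivrMr ?normr_gt0// mul1r.
  by rewrite ler0_norm; lra.
have [xq|qx] := leP x q.
  exists 0; first by lra.
  by rewrite mul0r subr0 in_itv/= cx.
have c0 : c != 0.
  by apply/eqP => c0; move: h2; rewrite c0 normr0; lra.
exists ((x - q) / c); last by rewrite divfK// in_itv/=; lra.
rewrite -ler_norml normrM normfV ler_pdivrMr ?normr_gt0// mul1r.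
by rewrite ger0_norm; lra.
Qed.

End segment_sum.

Section Vol_segment_sum.
Context {R : realType}.
Notation mu := (@lebesgue_measure R).

Definition shear_set n (w : 'rV[R]_n) (B : set 'rV[R]_n.+1) : set 'rV[R]_n.+1 :=
  [set z : 'rV[R]_n.+1 | B (z + z 0 ord0 *: cons_row 0 w)].

Lemma shear_set_compact n (w : 'rV[R]_n) B :
  compact B -> compact (shear_set w B).
Proof.
move=> cB; pose f (z : 'rV[R]_n.+1) := z - z 0 ord0 *: cons_row 0 w.
rewrite (_ : shear_set w B = f @` B).
  apply: compact_image => //; apply: row_continuous => j.
  rewrite (_ : (fun z => _) = (fun z : 'rV[R]_n.+1 =>
      z 0 j - z 0 ord0 * (cons_row 0 w) 0 j)); last first.
    by apply/funext => z; rewrite !mxE.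
  apply: continuous_sub; first exact: coord_continuous.
  by apply: continuous_mul; [exact: coord_continuous|exact: cst_continuous].
have f0 z c : (z + c *: cons_row 0 w) 0 ord0 = z 0 ord0.
  by rewrite [LHS]mxE [X in _ + X]mxE cons_row0 mulr0 addr0.
apply/seteqP; split=> [z Bz|_ [z Bz <-]].
  by exists (z + z 0 ord0 *: cons_row 0 w); rewrite // /f f0 addrK.
by rewrite /shear_set/= /f -scaleNr f0 scaleNr subrK.
Qed.

Lemma fiber_compact n (B : set 'rV[R]_n.+1) (y : 'rV[R]_n) :
  compact B -> compact [set x | B (cons_row x y)].
Proof.
move=> cB; rewrite (_ : [set x | _] =
    (fun z : 'rV[R]_n.+1 => z 0 ord0) @` (B `&` [set z | col' ord0 z = y])).
  apply: compact_image; first exact: coord_continuous.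
  apply: compact_closedI => //.
  apply: (@closed_comp _ _ (fun z : 'rV[R]_n.+1 => col' ord0 z) [set y]).
    move=> z _; apply: row_continuous => j.
    rewrite (_ : (fun x => _) =
      (fun x : 'rV[R]_n.+1 => x 0 (lift ord0 j))); first exact: coord_continuous.
    by apply/funext => x; rewrite mxE.
  by apply: compact_closed => //; exact: compact_set1.
apply/seteqP; split=> [x Bx|_ [z [Bz <-] <-]].
  exists (cons_row x y); last exact: cons_row0.
  by split=> //=; rewrite col'_cons_row.
by rewrite /= cons_row_col'.
Qed.

(* A shear makes [a] parallel to the first axis.  The fibers over the other
   coordinates are intervals, and each nonempty one grows by [2 |a_0|]. *)
Lemma Vol_segment_sum0 n (A : set 'rV[R]_n.+1) (a : 'rV[R]_n.+1) :
  compact A -> convex_rows A -> a 0 ord0 != 0 ->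
  Vol (segment_sum A a) =
  (Vol A + (2 * `|a 0 ord0|)%:E * Vol (project_along ord0 a @` A))%E.
Proof.
move=> cA vA a0.
(* With this slope the first axis of the sheared set corresponds to the direction [a / a_0], so a
   step [s a] becomes a step [s a_0] along that axis. *)
pose w : 'rV[R]_n := col' ord0 ((a 0 ord0)^-1 *: a).
have cSA := segment_sum_compact (a := a) cA.
rewrite -(Vol_shear w (compact_row_measurable cA)).
rewrite -(Vol_shear w (compact_row_measurable cSA)).
rewrite -!/(shear_set _ _).
have [m mE] := @lebesgue_tuple_sigma_finite R n.
pose F (y : 'rV[R]_n) : set R := [set x | shear_set w A (cons_row x y)].
have cF y : compact (F y) by exact/fiber_compact/shear_set_compact.
have vF y : forall x1 x2 t, F y x1 -> F y x2 -> 0 <= t <= 1 ->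
    F y (t * x1 + (1 - t) * x2).
  move=> x1 x2 t F1 F2 t01; have := vA _ _ t F1 F2 t01.
  rewrite /F /shear_set /=; congr A.
  apply: cons_rowP => [|k]; rewrite !mxE ?unlift_none ?liftK/= ?mxE; first ring.
  by ring.
pose Q : set 'rV[R]_n := project_along ord0 a @` A.
have QF y : Q y <-> F y !=set0.
  split=> [[z Az <-]|[x Fx]].
    exists (z 0 ord0); move: Az; rewrite /F/shear_set/=; congr A.
    apply: cons_rowP => [|k]; rewrite !mxE ?unlift_none ?liftK/= ?mxE.
      by rewrite mulr0 addr0.
    by rewrite ?liftK/= ?mxE; field.
  exists (cons_row x y + x *: cons_row 0 w).
    by move: Fx; rewrite /F/shear_set/= cons_row0.
  apply/rowP => k; rewrite !mxE ?unlift_none ?liftK/= ?mxE ?unlift_none ?liftK/=.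
  by rewrite ?mxE; field.
have cQ : compact Q.
  by apply: compact_image => //; exact: project_along_continuous.
have FS t : [set x | shear_set w (segment_sum A a) (cons_row x (row_of_tuple t))]
    = [set x | exists2 s, -1 <= s <= 1 & F (row_of_tuple t) (x - s * a 0 ord0)].
  apply/seteqP; split=> x /= [s s1] h; exists s => //; move: h;
    rewrite /F /shear_set /=; congr A.
    apply: cons_rowP => [|k]; rewrite !mxE ?unlift_none ?liftK/= ?mxE.
      by ring.
    by rewrite ?liftK/= ?mxE; field.
  apply: cons_rowP => [|k]; rewrite !mxE ?unlift_none ?liftK/= ?mxE.
    by ring.
  by rewrite ?liftK/= ?mxE; field.
have [mfA ->] := Vol_fiber mE
  (compact_row_measurable (shear_set_compact (w := w) cA)).
have [_ ->] := Vol_fiber mE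
  (compact_row_measurable (shear_set_compact (w := w) cSA)).
have mQ : measurable (@row_of_tuple R n @^-1` Q).
  exact: compact_row_measurable.
transitivity (\int[m]_t (mu (F (row_of_tuple t)) + (2 * `|a 0 ord0|)%:E *
   (\1_(@row_of_tuple R n @^-1` Q) t)%:E))%E.
  apply: eq_integral => t _; rewrite FS indicE.
  have [FF|F0] := pselect (F (row_of_tuple t) !=set0).
    by rewrite (compact_interval_sum _ FF (cF _) (vF _)) mem_set ?mule1//=; exact/QF.
  rewrite memNset; last by move=> /QF.
  rewrite mule0 adde0; congr mu.
  apply/seteqP; split=> x => [[s _ Fx]|Fx].
    by case: F0; exists (x - s * a 0 ord0).
  by case: F0; exists x.
have m1 : measurable_fun setT
    (fun t => (\1_(@row_of_tuple R n @^-1` Q) t)%:E : \bar R).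
  exact/measurable_EFinP/measurable_indic.
rewrite ge0_integralD//=; last exact: measurable_funeM.
rewrite ge0_integralZl//= integral_indic// setIT.
by congr (_ + _ * _)%E; rewrite /Vol -mE.
Qed.

(* Slicing along the leading coordinates, on which [a] vanishes, reduces to
   the case [j = 0]. *)
Lemma Vol_segment_sum n (A : set 'rV[R]_n.+1) (a : 'rV[R]_n.+1) (j : 'I_n.+1) :
  compact A -> convex_rows A -> (forall i : 'I_n.+1, (i < j)%N -> a 0 i = 0) ->
  a 0 j != 0 ->
  Vol (segment_sum A a) =
  (Vol A + (2 * `|a 0 j|)%:E * Vol (project_along j a @` A))%E.
Proof.
elim: n A a j => [|n IH] A a j cA vA ha aj.
  by rewrite (ord1 j) in ha aj *; exact: Vol_segment_sum0.
case: (unliftP ord0 j) => [j'|] Ej; last first.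
  by rewrite Ej in aj *; exact: Vol_segment_sum0.
rewrite {}Ej in ha aj *.
have a0 : a 0 ord0 = 0 by apply: ha; rewrite lift0.
pose a' := col' ord0 a.
have a'E k : a' 0 k = a 0 (lift ord0 k) by rewrite mxE.
have cP : compact (project_along (lift ord0 j') a @` A).
  by apply: compact_image => //; exact: project_along_continuous.
rewrite !Vol_slice.
rewrite -ge0_integralZl//=; first last.
- by move=> x _; exact: Vol_ge0.
- by apply: measurable_Vol_slice; exact: compact_row_measurable.
rewrite -ge0_integralD//=; first last.
- by apply: measurable_funeM; apply: measurable_Vol_slice;
    exact: compact_row_measurable.
- by move=> x _; apply: mule_ge0; [rewrite lee_fin mulr_ge0|exact: Vol_ge0].
- by apply: measurable_Vol_slice; exact: compact_row_measurable.
- by move=> x _; exact: Vol_ge0.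
apply: eq_integral => x _.
rewrite -a'E (_ : slice (segment_sum A a) x = segment_sum (slice A x) a').
  rewrite (IH _ _ j'); last first.
  - by rewrite a'E.
  - by move=> i ij; rewrite a'E ha// !lift0 ltnS.
  - exact: slice_convex.
  - exact: slice_compact.
  congr (_ + _ * Vol _)%E.
  (* Slicing commutes with the projection: since [a_0 = 0] the first coordinate is unchanged by it,
     and dropping a later coordinate leaves index 0 in place. *)
  apply/seteqP; split=> [_ [y Ay <-]|y [z Az Ez]].
    exists (cons_row x y) => //.
    apply: cons_rowP => [|k]; rewrite !mxE ?unlift_none ?liftK/=.
      rewrite (_ : lift (lift ord0 j') ord0 = ord0); last exact/val_inj.
      by rewrite unlift_none/= a0 mulr0 subr0.
    rewrite (_ : lift (lift ord0 j') (lift ord0 k) = lift ord0 (lift j' k)).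
      by rewrite liftK/= !mxE.
    by apply/val_inj; rewrite /= /bump/=; lia.
  have E0 : lift (lift ord0 j') ord0 = ord0 by exact/val_inj.
  have ES k : lift (lift ord0 j') (lift ord0 k) = lift ord0 (lift j' k).
    by apply/val_inj; rewrite /= /bump/=; lia.
  have Ex : z 0 ord0 = x.
    move/rowP/(_ ord0): Ez; rewrite cons_row0 !mxE E0 a0 mulr0 subr0.
    by [].
  exists (col' ord0 z).
    by rewrite /slice/= -Ex cons_row_col'.
  apply/rowP => k; move/rowP/(_ (lift ord0 k)): Ez.
  by rewrite cons_rowS => <-; rewrite !mxE ES.
apply/seteqP; split=> y [t t1 h]; exists t => //; move: h; rewrite /slice/=;
  congr A.
  by apply: cons_rowP => [|k]; rewrite !mxE ?unlift_none ?liftK/= ?mxE//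
    a0 mulr0 subr0.
by apply: cons_rowP => [|k]; rewrite !mxE ?unlift_none ?liftK/= ?mxE//
    a0 mulr0 subr0.
Qed.

End Vol_segment_sum.

(** * Volume of a zonotope *)

Section tuple_sum.
Context {R : realType} (T : Type) (phi : seq T -> R).

(* The sum of [phi (l ++ acc)] over all lists [l] of [m] elements of [s]. *)
Fixpoint tuple_sum m (s acc : seq T) : R :=
  if m is m'.+1 then \sum_(x <- s) tuple_sum m' s (x :: acc) else phi acc.

Hypothesis phi_swap : forall l1 l2 x y,
  phi (l1 ++ x :: y :: l2) = phi (l1 ++ y :: x :: l2).
Hypothesis phi_rep : forall l1 l2 x, phi (l1 ++ x :: x :: l2) = 0.

Lemma tuple_sum_swap m s l1 l2 x y :
  tuple_sum m s (l1 ++ x :: y :: l2) = tuple_sum m s (l1 ++ y :: x :: l2).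
Proof.
elim: m l1 => [|m IH] l1 //=.
by apply: eq_bigr => z _; rewrite -!cat_cons IH.
Qed.

Lemma tuple_sum_rep m s l1 l2 x : tuple_sum m s (l1 ++ x :: x :: l2) = 0.
Proof.
elim: m l1 => [|m IH] l1 //=.
by apply: big1 => z _; rewrite -!cat_cons IH.
Qed.

(** Sort the [m]-tuples by the number of times they draw the new entry [a]: two draws contribute 0
    because [phi] vanishes on repetitions, and a single draw can be moved next to [acc] from any of
    the [m] positions by symmetry. *)
Lemma tuple_sum_cons m a s acc :
  tuple_sum m (a :: s) acc =
  tuple_sum m s acc + m%:R * tuple_sum m.-1 s (a :: acc).
Proof.
elim: m acc => [|m IH] acc /=; first by rewrite mul0r addr0.
(* If [a] is drawn now, drawing it again later contributes 0. *)
rewrite big_cons IH (tuple_sum_rep _ _ [::]) mulr0 addr0.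
under eq_bigr do rewrite IH (tuple_sum_swap _ _ [::])/=.
rewrite big_split/= addrCA; congr (_ + _).
rewrite -mulr_sumr; case: m {IH} => [|m] /=; first by rewrite mul0r addr0 mul1r.
by rewrite [in RHS]mulrS mulrDl mul1r.
Qed.

End tuple_sum.

Section absdet.
Context {R : realType}.

(* Zero on lists of the wrong length, so that [absdet_swap] needs no hypothesis. *)
Definition absdet n (l : seq 'rV[R]_n) : R :=
  if size l == n then `|\det (\matrix_(i < n) nth 0 l i)| else 0.

Lemma absdet_swap n (l1 l2 : seq 'rV[R]_n) x y :
  absdet (l1 ++ x :: y :: l2) = absdet (l1 ++ y :: x :: l2).
Proof.
rewrite /absdet !size_cat/=; case: eqP => // sz.
have i1P : (size l1 < n)%N by lia.
have i2P : ((size l1).+1 < n)%N by lia.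
pose i1 := Ordinal i1P; pose i2 := Ordinal i2P.
have -> : \matrix_(i < n) nth 0 (l1 ++ y :: x :: l2) i =
    xrow i1 i2 (\matrix_(i < n) nth 0 (l1 ++ x :: y :: l2) i).
  apply/row_matrixP => i; rewrite rowK; apply/rowP => j; rewrite !mxE.
  case: tpermP => [->|->|/eqP ni1 /eqP ni2].
  - by rewrite !nth_cat/= ltnn subnn ltnNge leqnSn/= subSnn.
  - by rewrite !nth_cat/= ltnn subnn ltnNge leqnSn/= subSnn.
  - rewrite !nth_cat; case: ltnP => // li.
    have : (i - size l1)%N != 0%N.
      by apply: contraNneq ni1 => h; apply/eqP/val_inj/eqP;
        rewrite /= eqn_leq li -subn_eq0 h.
    have : (i - size l1)%N != 1%N.
      by apply: contraNneq ni2 => h; apply/eqP/val_inj;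
        rewrite /= -(subnK li) h.
    by case: (i - size l1)%N => [|[|k]].
by rewrite xrowE det_mulmx det_perm normrM normrX normrN normr1 expr1n mul1r.
Qed.

Lemma absdet_rep n (l1 l2 : seq 'rV[R]_n) x : absdet (l1 ++ x :: x :: l2) = 0.
Proof.
rewrite /absdet !size_cat/=; case: eqP => // sz.
have i1P : (size l1 < n)%N by lia.
have i2P : ((size l1).+1 < n)%N by lia.
rewrite (@determinant_alternate _ _ _ (Ordinal i1P) (Ordinal i2P)) ?normr0//.
  by apply/eqP => /(congr1 val)/=; lia.
by move=> j; rewrite !mxE !nth_cat/= ltnn subnn ltnNge leqnSn/= subSnn.
Qed.

Lemma absdet0 n (l1 l2 : seq 'rV[R]_n) : absdet (l1 ++ 0 :: l2) = 0.
Proof.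
rewrite /absdet !size_cat/=; case: eqP => // sz.
have i1P : (size l1 < n)%N by lia.
rewrite (expand_det_row _ (Ordinal i1P)) big1 ?normr0// => j _.
by rewrite mxE nth_cat/= ltnn subnn/= mxE mul0r.
Qed.

(** The counterpart for determinants of the volume gained by adding a segment. The row [a] stands
    last because [tuple_sum] starts from the accumulator [[:: a]] and conses in front of it. *)
Lemma absdet_project n (l : seq 'rV[R]_n.+1) (a : 'rV[R]_n.+1) (j : 'I_n.+1) :
  size l = n -> a 0 j != 0 ->
  absdet (l ++ [:: a]) = `|a 0 j| * absdet (map (project_along j a) l).
Proof.
move=> sz aj; rewrite /absdet size_cat size_map/= sz addn1 !eqxx.
pose M := \matrix_(i < n.+1) nth 0 (l ++ [:: a]) i.
have Mlast : row ord_max M = a by rewrite rowK nth_cat sz ltnn subnn.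
(* Row operations with pivot [a] clear column [j], except for its last entry. *)
pose c i := if i == ord_max then 0 else M i j / a 0 j.
pose M' := \matrix_(i < n.+1) (row i M - c i *: a).
have M'E i k : M' i k = M i k - c i * a 0 k by rewrite !mxE.
have aE k : a 0 k = M ord_max k by rewrite -[in LHS]Mlast mxE.
(* [L] adds [c i] times the last row to row [i]; since [c ord_max = 0] it is upper triangular with
   unit diagonal. *)
pose L : 'M[R]_n.+1 := 1%:M + \matrix_(i, k) (if k == ord_max then c i else 0).
have LM : M = L *m M'.
  apply/matrixP => i k; rewrite [RHS]mxE.
  rewrite (eq_bigr (fun p => (i == p)%:R * M' p k +
      (if p == ord_max then c i else 0) * M' p k)); last first.
    by move=> p _; rewrite !mxE mulrDl.
  rewrite big_split/= (bigD1 i)//= eqxx mul1r big1 ?addr0; last first.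
    by move=> p /negbTE; rewrite eq_sym => ->; rewrite mul0r.
  rewrite (bigD1 ord_max)//= eqxx [X in _ + (_ + X)]big1 ?addr0; last first.
    by move=> p /negbTE ->; rewrite mul0r.
  by rewrite !M'E aE [c ord_max]/c eqxx; ring.
have detL : \det L = 1.
  rewrite -det_tr det_trig.
    apply: big1 => i _; rewrite !mxE eqxx /c.
    by case: eqP; rewrite addr0.
  apply/is_trig_mxP => i k ik; rewrite !mxE.
  rewrite (_ : k == i = false); last by apply/eqP => E; rewrite E ltnn in ik.
  rewrite add0r; case: eqP => // E; move: ik; rewrite E ltnNge.
  by rewrite -ltnS ltn_ord.
rewrite -/M LM det_mulmx detL mul1r (expand_det_col _ j) (bigD1 ord_max)//=.
rewrite big1 ?addr0 => [|i /negbTE ni]; last first.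
  rewrite [M' i j]mxE /c ni !mxE.
  by rewrite divfK// subrr mul0r.
rewrite normrM; congr (_ * _).
  by rewrite mxE /c eqxx scale0r subr0 Mlast.
rewrite /cofactor normrM normrX normrN normr1 expr1n mul1r.
congr `|\det _|; apply/row_matrixP => i; rewrite rowK.
have li : lift ord_max i = i :> nat by rewrite lift_max.
rewrite (nth_map 0) ?sz//; apply/rowP => k; rewrite !mxE.
rewrite /c [_ == ord_max]eq_sym (negbTE (neq_lift _ _)).
by rewrite !mxE nth_cat sz lift_max ltn_ord.
Qed.

End absdet.

Section zonotope.
Context {R : realType}.

Definition zonotope n (s : seq 'rV[R]_n) : set 'rV[R]_n :=
  foldr (fun a A => segment_sum A a) [set 0] s.

Lemma zonotope_compact n (s : seq 'rV[R]_n) : compact (zonotope s).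
Proof.
by elim: s => [|a s IH] /=; [exact: compact_set1|exact: segment_sum_compact].
Qed.

Lemma zonotope_convex n (s : seq 'rV[R]_n) : convex_rows (zonotope s).
Proof.
elim: s => [|a s IH] /=; last exact: segment_sum_convex.
by move=> x y t -> -> _; rewrite /= !scaler0 addr0.
Qed.

Lemma segment_sum_0 n (A : set 'rV[R]_n) : segment_sum A 0 = A.
Proof.
apply/seteqP; split=> z; first by case=> t _; rewrite scaler0 subr0.
by move=> Az; exists 0; rewrite ?scaler0 ?subr0//; lra.
Qed.

Lemma project_along_segment_sum n (j : 'I_n.+1) (a b : 'rV[R]_n.+1) A :
  project_along j a @` segment_sum A b =
  segment_sum (project_along j a @` A) (project_along j a b).
Proof.
apply/seteqP; split=> [_ [z [t t1 Az] <-]|w [t t1 [z Az Ez]]].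
  exists t => //; exists (z - t *: b) => //.
  by apply/rowP => k; rewrite !mxE; ring.
exists (z + t *: b); first by exists t => //; rewrite addrK.
have -> : w = project_along j a z + t *: project_along j a b.
  by rewrite Ez subrK.
by apply/rowP => k; rewrite !mxE; ring.
Qed.

Lemma project_along_zonotope n (j : 'I_n.+1) (a : 'rV[R]_n.+1) s :
  project_along j a @` zonotope s = zonotope (map (project_along j a) s).
Proof.
elim: s => [|b s IH] /=; last by rewrite project_along_segment_sum IH.
rewrite image_set1; congr [set _].
by apply/rowP => k; rewrite !mxE; ring.
Qed.

(** Provides the pivot of [Vol_segment_sum], which asks the coordinates before [j] to vanish. *)
Lemma first_nonzero n (a : 'rV[R]_n) : a != 0 ->
  exists2 j : 'I_n, a 0 j != 0 & forall i : 'I_n, (i < j)%N -> a 0 i = 0.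
Proof.
move=> a0; have [i0 ai0] : exists i, a 0 i != 0.
  apply/existsP; apply: contraNT a0; rewrite negb_exists => /forallP h.
  by apply/eqP/rowP => i; have := h i; rewrite negbK mxE => /eqP.
case: (@arg_minnP _ i0 (fun i => a 0 i != 0) (fun i => i : nat) ai0) => j aj jmin.
exists j => // i ij; apply/eqP; apply: contraTT ij => ai.
by rewrite -leqNgt jmin.
Qed.

Lemma zonotope_nonempty n (s : seq 'rV[R]_n) : zonotope s 0.
Proof.
elim: s => [|a s IH] //=; exists 0; first by lra.
by rewrite scale0r subr0.
Qed.

Lemma Vol_set1 n (z : 'rV[R]_n.+1) : Vol [set z] = 0%E.
Proof.
rewrite Vol_slice -[RHS](integral_set1 (fun x => Vol (slice [set z] x)) (z 0 ord0)).
rewrite [RHS]integral_mkcond; apply: eq_integral => x _; rewrite patchE.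
case: ifPn => //; rewrite notin_setE /= => xz.
apply/eqP; rewrite eq_le Vol_ge0 andbT.
have -> : slice [set z] x = set0.
  apply/seteqP; split=> // y; rewrite /slice/= => E.
  by case: xz; rewrite -E cons_row0.
rewrite /Vol preimage_set0.
by have [m <-] := @lebesgue_tuple_sigma_finite R n; rewrite measure0.
Qed.

Lemma tuple_sum_absdet0 m n (s acc : seq 'rV[R]_n) :
  tuple_sum (@absdet R n) m s (0 :: acc) = 0.
Proof.
rewrite -[0 :: acc]/([::] ++ 0 :: acc).
elim: m [::] => [|m IH] l /=; first exact: absdet0.
by apply: big1 => x _; rewrite -cat_cons IH.
Qed.

Lemma tuple_sum_absdet_project m n (s l : seq 'rV[R]_n.+1)
    (a : 'rV[R]_n.+1) (j : 'I_n.+1) :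
  a 0 j != 0 -> (m + size l)%N = n ->
  tuple_sum (@absdet R n.+1) m s (l ++ [:: a]) = `|a 0 j| *
    tuple_sum (@absdet R n) m (map (project_along j a) s)
      (map (project_along j a) l).
Proof.
move=> aj; elim: m l => [|m IH] l /= sz; first exact: absdet_project.
rewrite big_map mulr_sumr; apply: eq_bigr => x _.
by rewrite -cat_cons IH//= addnS.
Qed.

(** Induction on the dimension and, inside it, on the number of segments. A zero generator has no
    pivot and is treated apart; it changes neither side. *)
Theorem Vol_zonotope n (s : seq 'rV[R]_n) :
  Vol (zonotope s) = (2 ^+ n / n`!%:R * tuple_sum (@absdet R n) n s [::])%:E.
Proof.
elim: n s => [|n IHn] s.
  rewrite Vol_dim0; last exact: zonotope_nonempty.
  by rewrite /= /absdet/= det_mx00 normr1 expr0 fact0 divr1 mulr1.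
elim: s => [|a s IH].
  by rewrite Vol_set1 /= big_nil mulr0.
rewrite tuple_sum_cons; first last.
- exact: absdet_rep.
- exact: absdet_swap.
have [->|a0] := eqVneq a 0.
  by rewrite /= segment_sum_0 IH tuple_sum_absdet0 mulr0 addr0.
have [j aj jmin] := first_nonzero a0.
rewrite [zonotope _]/= (Vol_segment_sum _ _ jmin aj); first last.
- exact: zonotope_convex.
- exact: zonotope_compact.
rewrite IH project_along_zonotope IHn -EFinM -EFinD; congr _%:E.
rewrite [in RHS]mulrDr; congr (_ + _).
rewrite -[[:: a]]/([::] ++ [:: a]).
rewrite (tuple_sum_absdet_project _ (l := [::]) aj) ?addn0//=.
have f0 : n`!%:R != 0 :> R by rewrite pnatr_eq0 -lt0n fact_gt0.
have n0 : n.+1%:R != 0 :> R by rewrite pnatr_eq0.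
(* The [n.+1] positions available to [a] turn [2 ^ n.+1 / n.+1!] into [2] times the constant
   [2 ^ n / n!] of the lower dimension. *)
by rewrite factS natrM exprS; field; rewrite f0 addrC natr1 n0.
Qed.

Lemma zonotopeP n (T : finType) (v : T -> 'rV[R]_n) z :
  zonotope (map v (enum T)) z <->
  exists2 t : T -> R, (forall j, -1 <= t j <= 1) & z = \sum_j t j *: v j.
Proof.
(* Without repetitions in [r], the coefficient of the head can be overwritten without touching those
   of the tail. *)
have H r : uniq r -> forall z, zonotope (map v r) z <->
    exists2 t : T -> R, (forall j, -1 <= t j <= 1) & z = \sum_(j <- r) t j *: v j.
  elim: r => [|j r IH] /=.
    move=> _ y; split=> [->|[t _ ->]]; last by rewrite big_nil.
    by exists (fun=> 0); [move=> _; lra|rewrite big_nil].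
  move=> /andP[jr ur] y; split.
    move=> [c c1 /(IH ur) [t t1 E]].
    exists (fun i => if i == j then c else t i).
      by move=> i; case: ifP.
    rewrite big_cons eqxx -[LHS](subrK (c *: v j)) addrC E; congr (_ + _).
    apply: eq_big_seq => i ir; case: eqP => // ij.
    by rewrite -ij ir in jr.
  move=> [t t1 ->]; exists (t j) => //; apply/(IH ur); exists t => //.
  by rewrite big_cons addrC addKr.
rewrite (H _ (enum_uniq T)).
by split=> -[t t1 ->]; exists t => //; rewrite big_enum.
Qed.

(** The last argument is split off because the element that [tuple_sum] draws first ends up behind
    all those drawn later. *)
Lemma sum_ffun_recr m (T : finType) (F : {ffun 'I_m.+1 -> T} -> R) :
  \sum_f F f = \sum_x \sum_(g : {ffun 'I_m -> T})
    F [ffun i => oapp g x (unlift ord_max i)].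
Proof.
rewrite pair_bigA/=.
rewrite (reindex (fun p : T * {ffun 'I_m -> T} =>
  [ffun i => oapp p.2 p.1 (unlift ord_max i)]))//=.
exists (fun f : {ffun 'I_m.+1 -> T} => (f ord_max, [ffun i => f (lift ord_max i)])).
  move=> [x g] _ /=; rewrite ffunE unlift_none/=; congr pair.
  by apply/ffunP => i; rewrite !ffunE liftK.
move=> f _; apply/ffunP => i; rewrite ffunE /=.
by case: (unliftP ord_max i) => [k|] -> /=; rewrite ?ffunE.
Qed.

Lemma tuple_sum_ffun (A : Type) (T : finType) (phi : seq A -> R) (v : T -> A)
    m acc :
  tuple_sum phi m (map v (enum T)) acc =
  \sum_(f : {ffun 'I_m -> T}) phi ([seq v (f i) | i <- enum 'I_m] ++ acc).
Proof.
elim: m acc => [|m IH] acc /=.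
  rewrite (eq_bigr (fun=> phi acc)) => [|f _]; last first.
    by rewrite (size0nil (size_enum_ord 0)).
  by rewrite sumr_const card_ffun card_ord expn0.
rewrite sum_ffun_recr big_map big_enum/=; apply: eq_bigr => x _.
rewrite IH; apply: eq_bigr => g _; congr phi.
rewrite enum_ordSr map_rcons cat_rcons -map_comp ffunE unlift_none/=.
congr (_ ++ _); apply: eq_map => i /=.
rewrite ffunE (_ : widen_ord _ i = lift ord_max i) ?liftK//.
by apply/val_inj; rewrite /= /bump leqNgt ltn_ord.
Qed.

Corollary Vol_zonotope_enum n (T : finType) (v : T -> 'rV[R]_n) :
  Vol (zonotope (map v (enum T))) = (2 ^+ n / n`!%:R *
    \sum_(f : {ffun 'I_n -> T}) `|\det (\matrix_(i < n) v (f i))|)%:E.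
Proof.
rewrite Vol_zonotope tuple_sum_ffun; congr (_ * _)%:E.
apply: eq_bigr => f _; rewrite cats0 /absdet size_map size_enum_ord eqxx.
congr `|\det _|; apply/row_matrixP => i; rewrite !rowK.
by rewrite (nth_map i) ?size_enum_ord// nth_ord_enum.
Qed.

End zonotope.

(** * Polarisation *)

Section polarization.
Context {R : realType} (n : nat).
Implicit Types (P : ('I_n -> R) -> R) (V : {ffun 'I_n -> 'I_n} -> R).

(** The polarisation formula: the sign is [(-1) ^ (n - #|S|)], and [P] is evaluated at the sum over
    [j] in [S] of the unit vectors [e_(g j)]. These points have nonnegative coordinates, where the
    volume polynomial is given. *)
Definition polarize P (g : {ffun 'I_n -> 'I_n}) : R :=
  n`!%:R^-1 * \sum_(S : {set 'I_n}) (\prod_i (if i \in S then 1 else -1)) *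
    P (fun i => \sum_(j in S) (g j == i)%:R).

Lemma sum_perm_ffun (F : {ffun 'I_n -> 'I_n} -> R) :
  \sum_(h : {ffun 'I_n -> 'I_n}) (injectiveb h)%:R * F h =
  \sum_(s : 'S_n) F [ffun k => s k].
Proof.
rewrite (bigID (fun h : {ffun 'I_n -> 'I_n} => injectiveb h))/=.
rewrite [X in _ + X]big1 ?addr0 => [|h /negbTE ->]; last by rewrite mul0r.
rewrite (reindex (fun s : 'S_n => pval s))/=; last first.
  exists (fun h : {ffun 'I_n -> 'I_n} => insubd (1%g : 'S_n) h) => [s _|h hP].
    exact: valKd.
  by have := insubdK (1%g : 'S_n) hP.
apply: eq_big => s; first by rewrite (valP s).
move=> ->; rewrite mul1r; congr F.
by apply/ffunP => k; rewrite ffunE pvalE.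
Qed.

(* Inclusion-exclusion: only the surjective [h] survive. *)
Lemma sum_signed_covers (h : {ffun 'I_n -> 'I_n}) :
  \sum_(S : {set 'I_n}) (\prod_i (if i \in S then 1 else -1)) *
    \prod_k (h k \in S)%:R = (injectiveb h)%:R :> R.
Proof.
(* Expanding the product chooses, for each [i], either the term 1, which puts [i] into [S], or the
   other term, which survives only if [h] does not take the value [i]. *)
transitivity (\prod_(i < n) (1 - (i \notin codom h)%:R) : R).
  rewrite bigA_distr/=; apply: eq_bigr => S _.
  have [hS|/forallPn[k hk]] := boolP [forall k, h k \in S].
    rewrite [X in _ * X]big1 ?mulr1 => [|k _]; last by rewrite (forallP hS).
    apply: eq_bigr => i _; case: ifP => // iS.
    rewrite (_ : i \notin codom h)//; apply: contraFN iS => /codomP[k ->].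
    exact: (forallP hS).
  rewrite [X in _ * X](bigD1 k)//= (negbTE hk) mul0r mulr0.
  by rewrite (bigD1 (h k))//= (negbTE hk) codom_f oppr0 mul0r.
have [hinj|hninj] := boolP (injectiveb h).
  apply: big1 => i _; rewrite (_ : i \in codom h) ?subr0//.
  by rewrite inj_card_onto//; exact/injectiveP.
have [i ih] : exists i, i \notin codom h.
  apply/existsP; apply: contraNT hninj; rewrite negb_exists => /forallP hs.
  have /image_injP hi : #|codom h| == #|'I_n|.
    by rewrite (@eq_card _ _ (mem 'I_n)) => // i; have := hs i; rewrite negbK => ->.
  by apply/injectiveP => x y; apply: hi.
by rewrite (bigD1 i)//= ih subrr mul0r.
Qed.

(** Expanding [P] at the point attached to [S] gives the sum of [V (g o h)] over the maps [h] with
    values in [S]. The signed sum over [S] keeps the bijective [h], and by symmetry each of these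
    [n!] terms equals [V g]. *)
Lemma polarizeP P V :
  (forall (s : 'S_n) (f : {ffun 'I_n -> 'I_n}), V [ffun k => f (s k)] = V f) ->
  (forall lam, (forall i, 0 <= lam i) ->
     P lam = \sum_(f : {ffun 'I_n -> 'I_n}) (\prod_k lam (f k)) * V f) ->
  forall g, V g = polarize P g.
Proof.
move=> Vs PE g; rewrite /polarize.
pose comp (h : {ffun 'I_n -> 'I_n}) : {ffun 'I_n -> 'I_n} := [ffun k => g (h k)].
have PS (S : {set 'I_n}) : P (fun i => \sum_(j in S) (g j == i)%:R) =
    \sum_(h : {ffun 'I_n -> 'I_n}) (\prod_k (h k \in S)%:R) * V (comp h).
  rewrite PE; last by move=> i; apply: sumr_ge0.
  (* The coordinate at [f k] counts the [j] in [S] with [g j = f k]; multiplying out over [k]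
     chooses one such [j = h k] for each [k]. *)
  transitivity (\sum_(f : {ffun 'I_n -> 'I_n}) \sum_(h : {ffun 'I_n -> 'I_n})
     (\prod_k (h k \in S)%:R * (comp h == f)%:R) * V f).
    apply: eq_bigr => f _.
    rewrite -mulr_suml; congr (_ * _).
    under eq_bigr do rewrite big_mkcond/=.
    rewrite bigA_distr_bigA/=; apply: eq_bigr => h _.
    have [<-|/eqP hf] := eqVneq (comp h) f.
      rewrite mulr1; apply: eq_bigr => k _.
      by rewrite ffunE eqxx; case: (_ \in _).
    rewrite mulr0.
    have [k hk] : exists k, g (h k) != f k.
      apply/existsP; apply: contra_notT hf; rewrite negb_exists => /forallP hh.
      by apply/ffunP => k; rewrite ffunE; have := hh k; rewrite negbK => /eqP.
    by rewrite (bigD1 k)//= (negbTE hk); case: ifP => _; rewrite mul0r.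
  rewrite exchange_big/=; apply: eq_bigr => h _.
  rewrite (bigD1 (comp h))//= eqxx mulr1 [X in _ + X]big1 ?addr0// => f /negbTE.
  by rewrite eq_sym => ->; rewrite mulr0 mul0r.
under eq_bigr do rewrite PS mulr_sumr.
rewrite exchange_big/=.
under eq_bigr do under eq_bigr do rewrite mulrA.
under eq_bigr do rewrite -mulr_suml sum_signed_covers.
rewrite sum_perm_ffun.
rewrite (eq_bigr (fun=> V g)) => [|s _]; last first.
  by rewrite -[RHS](Vs s); congr V; apply/ffunP => k; rewrite !ffunE.
rewrite sumr_const card_Sn -[V g *+ _]mulr_natl mulKf//.
Qed.

End polarization.

(** * Moments of the normal law *)

Section normal_moments.
Context {R : realType}.
Notation mu := (@lebesgue_measure R).

(** Change of variables holds for the Radon-Nikodym derivative, which equals [normal_pdf] almost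
    everywhere since both have the same integral over every measurable set. *)
Lemma ge0_integral_normal_prob (m s : R) (f : R -> \bar R) :
  (forall x, 0 <= f x)%E -> measurable_fun setT f ->
  (\int[normal_prob m s]_x f x = \int[mu]_x (f x * (normal_pdf m s x)%:E))%E.
Proof.
move=> f0 mf; have dom := normal_prob_dominates m s.
rewrite -(Radon_Nikodym_SigmaFinite.change_of_variables dom)//.
pose h := Radon_Nikodym_SigmaFinite.f (normal_prob m s) mu.
have hint : mu.-integrable setT h by exact: Radon_Nikodym_SigmaFinite.f_integrable.
have mpdf : measurable_fun setT (fun x => (normal_pdf m s x)%:E).
  by apply/measurable_EFinP; exact: measurable_normal_pdf.
apply: ae_eq_integral => //.
- by apply: emeasurable_funM => //; exact: measurable_int hint.
- exact: emeasurable_funM.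
- have : ae_eq mu setT h (fun x => (normal_pdf m s x)%:E).
    apply: integral_ae_eq => // E _ mE.
    by rewrite -Radon_Nikodym_SigmaFinite.f_integral.
  by apply: filterS => x /= hx _; rewrite -/h hx.
Qed.

Variable s : R.
Hypothesis s0 : s != 0.

Local Notation phi := (normal_pdf 0 s).

Let phiE x : phi x = normal_peak s * expR (- x ^+ 2 / (s ^+ 2 *+ 2)).
Proof. by rewrite normal_pdfE// /normal_fun subr0. Qed.

Let cphi : continuous phi.
Proof. exact: continuous_normal_pdf. Qed.

Let phi_cvg0 : phi x @[x --> +oo] --> (0 : R).
Proof.
have c0 : 0 < Num.sqrt (s ^+ 2 *+ 2).
  by rewrite sqrtr_gt0 pmulrn_lgt0// exprn_even_gt0.
rewrite (_ : phi = (fun x => normal_peak s * gauss_fun (x / Num.sqrt (s ^+ 2 *+ 2)))).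
  rewrite -[X in _ --> X](mulr0 (normal_peak s)); apply: cvgM; first exact: cvg_cst.
  apply: (cvg_comp (fun x => x / Num.sqrt (s ^+ 2 *+ 2)) gauss_fun).
    by apply: gt0_cvgMly; [rewrite invr_gt0|exact: cvg_id].
  exact: cvg_gauss_fun.
apply/funext => x; rewrite phiE /gauss_fun; congr (_ * expR _).
by rewrite exprMn exprVn sqr_sqrtr ?mulNr// pmulrn_lge0// sqr_ge0.
Qed.

Let F x := - s ^+ 2 * phi x.

Let dF (x : R) : is_derive x 1 F (x * phi x).
Proof.
rewrite /F (_ : (fun y => _) = (fun y => - s ^+ 2 * normal_peak s *
   expR (- (s ^+ 2 *+ 2)^-1 * y ^+ 2))); last first.
  by apply/funext => y; rewrite phiE mulrA; congr (_ * expR _); ring.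
apply: is_derive_eq.
rewrite phiE (_ : - x ^+ 2 / _ = - (s ^+ 2 *+ 2)^-1 * x ^+ 2); last by ring.
by rewrite /GRing.scale/=; field.
Qed.

Let cxphi : continuous (fun x : R => x * phi x).
Proof. by move=> x; apply: cvgM; [exact: cvg_id|exact: cphi]. Qed.

Let integral_tail (t : R) : 0 <= t ->
  (\int[mu]_(x in `[t, +oo[) (x * phi x)%:E = (s ^+ 2 * phi t)%:E)%E.
Proof.
move=> t0; rewrite (@ge0_continuous_FTC2y _ _ F _ 0)//.
- by rewrite /F -EFinB sub0r mulNr opprK.
- by move=> x tx; rewrite mulr_ge0 ?normal_pdf_ge0// (le_trans t0).
- exact: continuous_subspaceT.
- rewrite -[X in _ --> X](mulr0 (- s ^+ 2)); apply: cvgM => //.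
  exact: cvg_cst.
- by move=> x _; exact: (@ex_derive _ _ _ _ _ _ _ (dF x)).
- by apply: cvg_at_right_filter; apply: cvgM; [exact: cvg_cst|exact: cphi].
- by move=> x _; rewrite derive1E; exact: (@derive_val _ _ _ _ _ _ _ (dF x)).
Qed.

Let phiN x : phi (- x) = phi x.
Proof. by rewrite !phiE sqrrN. Qed.

Lemma integral_abs_normal_pdf :
  (\int[mu]_x (`|x| * phi x)%:E = (2 * (s ^+ 2 * phi 0))%:E)%E.
Proof.
rewrite ge0_symfun_integralT.
- rewrite EFinM -integral_tail// set_itvcy; congr (_ * _)%E.
  by apply: eq_integral => x; rewrite inE/= => x0; rewrite ger0_norm.
- by move=> x; rewrite mulr_ge0 ?normal_pdf_ge0.
- by move=> x; apply: cvgM; [exact: norm_continuous|exact: cphi].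
- by move=> x; rewrite /= normrN phiN.
Qed.

Lemma integral_pos_normal_pdf :
  (\int[mu]_x (Num.max x 0 * phi x)%:E = (s ^+ 2 * phi 0)%:E)%E.
Proof.
rewrite -integral_tail// [RHS]integral_mkcond; apply: eq_integral => x _.
rewrite patchE; case: ifPn; rewrite ?notin_setE ?inE/= in_itv/= andbT => x0.
  by rewrite max_l.
by rewrite max_r ?mul0r// leNgt; apply/negP => /ltW.
Qed.

(* Tonelli, after writing one of the two factors [x] as [\int_0^x dt]. *)
Lemma integral_sqr_normal_pdf :
  (\int[mu]_x (x ^+ 2 * phi x)%:E = (s ^+ 2)%:E)%E.
Proof.
pose D : set (R * R) := [set p | 0 <= p.1 <= p.2].
have mD : measurable D.
  rewrite (_ : D = (fun p : R * R => (0 <= p.1) && (p.1 <= p.2)) @^-1` [set true]).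
    rewrite -[X in measurable X]setTI.
    have mf : measurable_fun [set: R * R] (fun p : R * R => (0 <= p.1) && (p.1 <= p.2)).
      by apply: measurable_and; apply: measurable_fun_ler.
    exact: mf.
  by [].
pose f (p : R * R) : \bar R := (\1_D p * (p.2 * phi p.2))%:E.
have mf : measurable_fun setT f.
  apply/measurable_EFinP/measurable_funM; first exact: measurable_indic.
  apply: measurable_funM => //; apply: measurableT_comp => //.
  exact: measurable_normal_pdf.
have f0 p : (0 <= f p)%E.
  rewrite lee_fin indicE; case: (boolP (p \in D)) => //=; rewrite ?mul0r// mul1r.
  rewrite inE => /andP[p0 p1].
  by rewrite mulr_ge0 ?normal_pdf_ge0// (le_trans p0).
have := fubini_tonelli (m1 := mu) (m2 := mu) f mf f0.
have -> : (\int[mu]_t \int[mu]_x f (t, x) = ((s ^+ 2) / 2)%:E)%E.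
  transitivity (\int[mu]_(t in `[0%R, +oo[) (s ^+ 2 * phi t)%:E)%E.
    rewrite [RHS]integral_mkcond; apply: eq_integral => t _.
    rewrite patchE; case: ifPn; rewrite ?notin_setE ?inE/= in_itv/= andbT => t0.
      rewrite -integral_tail// [RHS]integral_mkcond; apply: eq_integral => x _.
      rewrite patchE /f indicE; case: ifPn; rewrite ?notin_setE ?inE/= in_itv/= andbT => tx.
        by rewrite mem_set ?mul1r//; apply/andP.
      by rewrite memNset ?mul0r// => /andP[_ /tx].
    apply: integral0_eq => x _; rewrite /f indicE memNset ?mul0r//.
    by move=> /andP[/t0].
  under eq_integral do rewrite EFinM.
  rewrite ge0_integralZl//; last 3 first.
  - by apply/measurable_EFinP/measurable_funTS; exact: measurable_normal_pdf.
  - by move=> x _; rewrite lee_fin normal_pdf_ge0.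
  - by rewrite lee_fin sqr_ge0.
  have := integral_normal_pdf (0 : R) s.
  rewrite ge0_symfun_integralT//; last 2 first.
  - by move=> x; exact: normal_pdf_ge0.
  - by move=> x; rewrite /= phiN.
  rewrite -set_itvcy; set J := (\int[_]_(x in _) _)%E.
  move=> J2; have : (2^-1%:E * (2%:E * J) = 2^-1%:E)%E by rewrite J2 mule1.
  by rewrite muleA -EFinM mulVf// mul1e => ->; rewrite -EFinM.
have -> : (\int[mu]_x \int[mu]_t f (t, x) =
    \int[mu]_(x in [set x | (0 <= x)%R]) (x ^+ 2 * phi x)%:E)%E.
  rewrite [RHS]integral_mkcond; apply: eq_integral => x _.
  rewrite patchE; case: ifPn; rewrite ?notin_setE ?inE/= => x0; last first.
    apply: integral0_eq => t _; rewrite /f indicE memNset ?mul0r//.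
    by move=> /= /andP[/le_trans h /h].
  transitivity (\int[mu]_(t in `[0%R, x]) (x * phi x)%:E)%E.
    rewrite [RHS]integral_mkcond; apply: eq_integral => t _.
    rewrite patchE /f indicE; case: ifPn; rewrite ?notin_setE ?inE/= in_itv/= => tx.
      by rewrite mem_set ?mul1r.
    by rewrite memNset ?mul0r.
  rewrite integral_cst//= lebesgue_measure_itv/= lte_fin.
  have [x0'|x0'] := ltP 0 x; first by rewrite -EFinB -EFinM; congr _%:E; ring.
  by rewrite (_ : x = 0) ?mule0 ?expr0n/= ?mul0r//; apply/eqP; rewrite eq_le x0' x0.
move=> E; rewrite ge0_symfun_integralT.
- by rewrite -E -EFinM; congr _%:E; field.
- by move=> x; rewrite mulr_ge0 ?normal_pdf_ge0// sqr_ge0.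
- by move=> x; apply: cvgM; [exact: sqr_continuous|exact: cphi].
- by move=> x; rewrite /= sqrrN phiN.
Qed.

End normal_moments.

(** * Moments of a centered Gaussian variable *)

Section gaussian_law_moments.
Context {R : realType}.
Notation mu := (@lebesgue_measure R).
Context (disp : measure_display) (Omega : measurableType disp)
  (P : probability Omega R) (Y : {RV P >-> R}) (m s : R).
Hypothesis Ylaw : forall A : set R, measurable A ->
  P [set w | A (Y w)] = gaussian_law m s A.
Hypothesis EY0 : ('E_P[Y] = 0)%E.

Let mY : measurable_fun setT Y.
Proof. exact: measurable_funPT. Qed.

Let degenerate (f : R -> \bar R) : s = 0 ->
  measurable_fun setT f -> (forall x, 0 <= f x)%E ->
  (\int[P]_w f (Y w) = f m)%E.
Proof.
move=> s0 mf f0; rewrite -(ge0_integral_distribution Y)//.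
transitivity (\int[\d_m]_x f x)%E.
  by apply: eq_measure_integral => A mA _; rewrite -[LHS]/(P _) Ylaw// /gaussian_law s0 eqxx.
by rewrite integral_dirac// diracT mul1e.
Qed.

Let nondegenerate (g : R -> R) : s != 0 ->
  measurable_fun setT g -> (forall x, 0 <= g x) ->
  (\int[P]_w (g (Y w - m))%:E = \int[mu]_x (g x * normal_pdf 0 s x)%:E)%E.
Proof.
move=> s0 mg g0.
have mgm : measurable_fun [set: R] (fun x : R => (g (x - m))%:E).
  by apply/measurable_EFinP; apply: measurableT_comp => //; exact: measurable_addr.
transitivity (\int[pushforward P (Y : Omega -> measurableTypeR R)]_x (g (x - m)%R)%:E)%E.
  rewrite (@ge0_integral_pushforward _ _ Omega (measurableTypeR R) R Y mY)//=.
  by move=> x _; rewrite lee_fin.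
transitivity (\int[normal_prob m s]_x (g (x - m))%:E)%E.
  apply: eq_measure_integral => A mA _.
  by rewrite -[LHS]/(P _) -[LHS]/(P [set w | A (Y w)]) Ylaw// /gaussian_law (negbTE s0).
rewrite ge0_integral_normal_prob//; last by move=> x; rewrite lee_fin.
rewrite -(ge0_integral_shift m)//; last 2 first.
- apply: emeasurable_funM => //; apply/measurable_EFinP.
  exact: measurable_normal_pdf.
- by move=> x; rewrite -EFinM lee_fin mulr_ge0 ?normal_pdf_ge0.
apply: eq_integral => x _; rewrite addrK -EFinM; congr (_ * _)%:E.
by rewrite !normal_pdfE// /normal_fun addrK subr0.
Qed.

(** The parameter [m] is so far unrelated to the expectation. For [s != 0] the positive and negative
    parts of [Y - m] have the same finite integral, hence [Y] has mean [m]; for [s = 0] it is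
    constant almost surely. *)
Let mean_eq0 : m = 0.
Proof.
have [s0|s0] := eqVneq s 0.
  have absY : (\int[P]_w `|(Y w)%:E| = `|m%:E|)%E.
    rewrite (degenerate (f := fun x => `|x%:E|%E))//.
    exact/measurableT_comp/measurable_EFinP.
  have iY : P.-integrable setT (EFin \o Y).
    by apply/integrableP; split; [exact/measurable_EFinP|rewrite absY ltry].
  move: EY0; rewrite unlock -(integral_distribution (f := EFin))//.
  rewrite (_ : integral _ _ _ = \int[\d_m]_x x%:E)%E; last first.
    by apply: eq_measure_integral => A mA _; rewrite -[LHS]/(P _) Ylaw// /gaussian_law s0 eqxx.
  by rewrite integral_dirac// diracT mul1e => -[].
have mYm : measurable_fun setT (fun w => Y w - m).
  by apply: measurable_funB.
(* Half the mean of [|Y - m|], which is the mean of the positive part. *)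
pose k := s ^+ 2 * normal_pdf 0 s 0.
have Eabs : (\int[P]_w (`|Y w - m|)%:E = (2 * k)%:E)%E.
  by rewrite (nondegenerate (g := fun x => `|x|))// ?integral_abs_normal_pdf//.
have Epos : (\int[P]_w (Num.max (Y w - m) 0)%:E = k%:E)%E.
  rewrite (nondegenerate (g := fun x => Num.max x 0))//.
  - exact: integral_pos_normal_pdf.
  - exact: measurable_maxr.
  - by move=> x; rewrite le_max lexx orbT.
have Eneg : (\int[P]_w (Num.max (- (Y w - m)) 0)%:E = k%:E)%E.
  have : (\int[P]_w ((Num.max (Y w - m) 0)%:E + (Num.max (- (Y w - m)) 0)%:E) = (2 * k)%:E)%E.
    rewrite -Eabs; apply: eq_integral => w _; rewrite -EFinD; congr _%:E.
    case: (boolP (0 <= Y w - m)) => h.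
      by rewrite max_l// max_r ?oppr_le0// addr0 ger0_norm.
    move: h; rewrite -ltNge => h.
    by rewrite max_r ?ltW// max_l ?oppr_ge0 ?ltW// add0r ltr0_norm.
  rewrite ge0_integralD//; last 4 first.
  - by move=> w _; rewrite lee_fin le_max lexx orbT.
  - by apply/measurable_EFinP; exact: measurable_maxr.
  - by move=> w _; rewrite lee_fin le_max lexx orbT.
  - by apply/measurable_EFinP; apply: measurable_maxr => //; exact: measurableT_comp.
  rewrite Epos; set J := (\int[P]_w _)%E => E.
  have -> : J = ((2 * k)%:E - k%:E)%E by rewrite -E [(_ + J)%E]addeC addeK.
  by rewrite -EFinB; congr _%:E; ring.
have iYm : P.-integrable setT (fun w => (Y w - m)%:E).
  apply/integrableP; split; first exact/measurable_EFinP.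
  by rewrite Eabs ltry.
have EYm : (\int[P]_w (Y w - m)%:E = 0)%E.
  rewrite integralE.
  rewrite (_ : (fun w => _)^\+ = (fun w => (Num.max (Y w - m) 0)%:E))%E; last first.
    by apply/funext => w; rewrite funeposE EFin_max.
  rewrite (_ : (fun w => _)^\- = (fun w => (Num.max (- (Y w - m)) 0)%:E))%E; last first.
    by apply/funext => w; rewrite funenegE EFin_max.
  by rewrite Epos Eneg subee.
have : ('E_P[Y] = m%:E)%E.
  rewrite unlock (eq_integral (fun w => (Y w - m)%:E + m%:E)%E); last first.
    by move=> w _; rewrite -EFinD subrK.
  rewrite integralD//; last exact: finite_measure_integrable_cst.
  by rewrite EYm add0e -[RHS]mule1 -(probability_setT P) -integral_cst.
by rewrite EY0 => -[].
Qed.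

Lemma gaussian_second_moment : (\int[P]_w (Y w ^+ 2)%:E = (s ^+ 2)%:E)%E.
Proof.
have [s0|s0] := eqVneq s 0.
  rewrite (degenerate (f := fun x => (x ^+ 2)%:E))//.
  - by rewrite mean_eq0 s0.
  - by apply/measurable_EFinP; exact: measurable_funX.
  - by move=> x; rewrite lee_fin sqr_ge0.
rewrite -integral_sqr_normal_pdf// -(nondegenerate (g := fun x => x ^+ 2))//.
- by apply: eq_integral => w _; rewrite mean_eq0 subr0.
- by move=> x; rewrite sqr_ge0.
Qed.

(** The value [2 s^2 phi(0)] with [phi(0) = 1 / (|s| sqrt (2 pi))]. The absolute value is there
    because the law admits negative [s]. *)
Lemma gaussian_abs_moment :
  (\int[P]_w (`|Y w|)%:E = (Num.sqrt (2 / pi) * `|s|)%:E)%E.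
Proof.
have [s0|s0] := eqVneq s 0.
  rewrite (degenerate (f := fun x => (`|x|)%:E))//.
    by rewrite mean_eq0 s0 normr0 mulr0.
  by apply/measurable_EFinP.
transitivity (\int[P]_w (`|Y w - m|)%:E)%E.
  by apply: eq_integral => w _; rewrite mean_eq0 subr0.
rewrite (nondegenerate (g := fun x => `|x|))// integral_abs_normal_pdf//.
congr _%:E; rewrite normal_pdfE// /normal_fun subr0 expr0n/= oppr0 mul0r expR0 mulr1.
have p0 : 0 < pi :> R by exact: pi_gt0.
rewrite /normal_peak -mulrnAr sqrtrM ?sqr_ge0// sqrtr_sqr.
apply: (mulfI (x := Num.sqrt (pi *+ 2))); first by rewrite gt_eqF// sqrtr_gt0 mulrn_wgt0.
have p2 : 0 <= pi *+ 2 :> R by rewrite mulrn_wge0 ?ltW.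
rewrite [RHS]mulrA -sqrtrM//.
rewrite (_ : pi *+ 2 * (2 / pi) = 2 ^+ 2 :> R); last by field; lra.
rewrite sqrtr_sqr normr_nat -[s ^+ 2]real_normK ?num_real//.
by field; rewrite normr_eq0 s0 gt_eqF// sqrtr_gt0 mulrn_wgt0.
Qed.

End gaussian_law_moments.

(** * Discretisation of the random vectors *)

Section quantizer.
Context {R : realType}.

(** A sign and a level; the top level [n * n.+1] on the grid of step [1 / n.+1] is the value [n]. *)
Definition quant_index (n : nat) : finType := (bool * 'I_(n * n.+1).+1)%type.

(* Rounding towards 0 on the grid of step [1 / n.+1]; arguments beyond [n] get
   level 0. *)
Definition quant_level (n : nat) (x : R) : nat :=
  let k := Num.truncn (`|x| * n.+1%:R) in if (k <= n * n.+1)%N then k else 0%N.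

Definition quant (n : nat) (x : R) : quant_index n :=
  (x < 0, inord (quant_level n x)).

Definition dequant (n : nat) (k : quant_index n) : R :=
  (-1) ^+ k.1 * (k.2%:R / n.+1%:R).

Lemma quant_level_le n x : (quant_level n x <= n * n.+1)%N.
Proof. by rewrite /quant_level; case: ifP. Qed.

Lemma dequant_quantE n x :
  dequant (quant n x) = (-1) ^+ (x < 0)%R * ((quant_level n x)%:R / n.+1%:R).
Proof. by rewrite /dequant /= inordK// ltnS quant_level_le. Qed.

(** The reason for rounding towards 0 and for level 0 out of range: the original variable dominates
    all its discretisations, as dominated convergence requires. *)
Lemma dequant_norm n x : `|dequant (quant n x)| <= `|x|.
Proof.
rewrite dequant_quantE normrM normrX normrN normr1 expr1n mul1r.
rewrite ger0_norm ?divr_ge0// ler_pdivrMr ?ltr0n// /quant_level.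
case: ifP => _; last by rewrite mulr_ge0.
by rewrite truncn_le// mulr_ge0.
Qed.

Lemma dequant_error n x : `|x| <= n%:R ->
  `|dequant (quant n x) - x| <= n.+1%:R^-1.
Proof.
move=> xn; have n0 : 0 < n.+1%:R :> R by rewrite ltr0n.
have y0 : 0 <= `|x| * n.+1%:R by rewrite mulr_ge0.
have /andP[h1 h2] := truncn_itv y0.
have lev : quant_level n x = Num.truncn (`|x| * n.+1%:R).
  rewrite /quant_level ifT// -(ler_nat R) (le_trans h1)//.
  by rewrite natrM ler_wpM2r.
have xE : (-1) ^+ (x < 0)%R * `|x| = x.
  have [h|] := boolP (x < 0); first by rewrite expr1 mulN1r ltr0_norm ?opprK.
  by rewrite -leNgt => h; rewrite expr0 mul1r ger0_norm.
rewrite dequant_quantE lev -[X in _ - X]xE -mulrBr.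
rewrite normrM normrX normrN normr1 expr1n mul1r.
rewrite ler0_norm; last by rewrite subr_le0 ler_pdivrMr.
rewrite opprB lerBlDr -[X in X + _]mul1r -mulrDl ler_pdivlMr// addrC natr1.
exact: ltW.
Qed.

Lemma dequant_cvg x : dequant (quant n x) @[n --> \oo] --> x.
Proof.
apply/cvgrPdist_le => e e0; near=> n.
rewrite distrC (le_trans (dequant_error _))//.
  near: n; exists (Num.truncn `|x|).+1 => // n /= xn.
  by rewrite (le_trans (ltW (truncnS_gt _)))// ler_nat.
near: n; exists (Num.truncn e^-1).+1 => // n /= en.
rewrite invf_ple ?posrE//; apply: (le_trans (ltW (truncnS_gt _))).
by rewrite ler_nat (leq_trans en).
Unshelve. all: by end_near. Qed.

Lemma quant_level_measurable n (A : set nat) :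
  measurable [set x : R | A (quant_level n x)].
Proof.
pose f (k : nat) := if (k <= n * n.+1)%N then k else 0%N.
rewrite (_ : [set x | _] = \bigcup_(k in [set k | A (f k)])
   ((fun x : R => `|x| * n.+1%:R) @^-1` `[k%:R, k.+1%:R[%classic)).
  apply: bigcup_measurable => k _; rewrite -[X in measurable X]setTI.
  have mf : measurable_fun [set: R] (fun x : R => `|x| * n.+1%:R).
    by apply: measurable_funM => //; exact: measurableT_comp.
  by apply: mf => //; exact: measurable_itv.
apply/seteqP; split=> x /=.
  move=> Ax; exists (Num.truncn (`|x| * n.+1%:R)) => //=.
  by rewrite in_itv/= truncn_itv// mulr_ge0.
move=> [k Ak]; rewrite /= in_itv/= => h.
rewrite /quant_level (_ : Num.truncn _ = k)//.
exact: truncn_def.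
Qed.

Lemma quant_measurable n (k : quant_index n) :
  measurable [set x : R | quant n x = k].
Proof.
rewrite (_ : [set x | _] = ((fun x : R => x < 0) @^-1` [set k.1]) `&`
   [set x : R | inord (quant_level n x) = k.2]).
  apply: measurableI.
    rewrite -[X in measurable X]setTI.
    have mf : measurable_fun [set: R] (fun x : R => x < 0).
      exact: measurable_fun_ltr.
    exact: mf.
  exact: (quant_level_measurable n (fun l => inord l = k.2)).
apply/seteqP; split=> x /=; first by move=> <-.
by case: k => b l /= [h1 h2]; rewrite /quant h1 h2.
Qed.

Variable d : nat.

Definition row_quant_index (n : nat) : finType := {ffun 'I_d -> quant_index n}.

Definition row_quant n (t : d.-tuple R) : row_quant_index n :=
  [ffun l => quant n (tnth t l)].

Definition row_dequant n (k : row_quant_index n) : 'rV[R]_d :=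
  \row_l dequant (k l).

Lemma row_quant_measurable n (k : row_quant_index n) :
  measurable [set t | row_quant n t = k].
Proof.
rewrite (_ : [set t | _] = \bigcap_(l in [set: 'I_d])
    ((@tnth d R)^~ l @^-1` [set x | quant n x = k l])).
  apply: fin_bigcap_measurable => // l _; rewrite -[X in measurable X]setTI.
  by apply: (@measurable_tnth _ R) => //; exact: quant_measurable.
apply/seteqP; split=> t /=.
  by move=> <- l _ /=; rewrite ffunE.
by move=> h; apply/ffunP => l; rewrite ffunE; exact: h.
Qed.

Lemma row_dequantE n t l :
  row_dequant (row_quant n t) 0 l = dequant (quant n (tnth t l)).
Proof. by rewrite mxE ffunE. Qed.

End quantizer.

Section finite_valued.
Context {R : realType} (disp : measure_display) (Omega : measurableType disp)
  (P : probability Omega R).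

Lemma integral_finite_valued (J : finType) (q : Omega -> J) (F : J -> R) :
  (forall j, measurable [set w | q w = j]) -> (forall j, 0 <= F j) ->
  (\int[P]_w (F (q w))%:E =
   (\sum_j F j * fine (P [set w | q w = j]))%:E)%E.
Proof.
move=> mq F0.
rewrite (eq_integral (fun w => \sum_j (F j)%:E * (\1_[set w | q w = j] w)%:E)%E); last first.
  move=> w _; rewrite (bigD1 (q w))//= indicE mem_set// mule1 big1 ?adde0// => j /eqP nj.
  by rewrite indicE memNset ?mule0//= => /esym.
rewrite ge0_integral_sum//; last 2 first.
- move=> j; apply: emeasurable_funM => //.
  exact/measurable_EFinP/measurable_indic.
- by move=> j w _; rewrite mule_ge0// lee_fin.
rewrite -sumEFin; apply: eq_bigr => j _.
rewrite ge0_integralZl//; last 2 first.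
- exact/measurable_EFinP/measurable_indic.
- by rewrite lee_fin.
by rewrite integral_indic// setIT EFinM fineK// fin_num_measure.
Qed.

End finite_valued.

Section discretised_vectors.
Context {R : realType} (disp : measure_display) (Omega : measurableType disp)
  (P : probability Omega R) (d : nat) (xi : 'I_d -> {RV P >-> d.-tuple R}).
Hypothesis xi_indep : mutually_independent xi.
Hypothesis xi_int : forall i l,
  P.-integrable setT (fun w => (tnth (xi i w) l)%:E).

Definition discr (n : nat) i w : 'rV[R]_d := row_dequant (row_quant n (xi i w)).

Definition discr_prob (n : nat) i (k : row_quant_index d n) : R :=
  fine (P [set w | row_quant n (xi i w) = k]).

Lemma discr_prob_ge0 n i k : 0 <= @discr_prob n i k.
Proof. by rewrite fine_ge0. Qed.

Lemma discr_measurable n i k :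
  measurable [set w | row_quant n (xi i w) = k].
Proof.
rewrite -[X in measurable X]setTI.
exact: (@measurable_funPT _ _ _ _ (xi i) measurableT _ (row_quant_measurable k)).
Qed.

(** Independence enters here and nowhere else, for the events that the discretised vectors take
    prescribed values. *)
Lemma discr_joint_prob n (j : {ffun 'I_d -> row_quant_index d n}) :
  fine (P [set w | [ffun i => row_quant n (xi i w)] = j]) =
  \prod_i discr_prob i (j i).
Proof.
have := xi_indep [set: 'I_d]%SET (fun i => row_quant_measurable (j i)).
set A := (X in P X = _); rewrite (_ : [set w | _] = A); last first.
  rewrite /A; apply/seteqP; split=> w /=.
    by move=> <- i _ /=; rewrite ffunE.
  by move=> h; apply/ffunP => i; rewrite ffunE; apply: h; rewrite /= finset.in_setT.
move=> ->.
rewrite (_ : (\prod_(i in _) _)%E = \prod_i (discr_prob i (j i))%:E)%E.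
  by rewrite prodEFin.
apply: eq_big => i; first by rewrite finset.in_setT.
by rewrite fineK// fin_num_measure//; exact: discr_measurable.
Qed.

Lemma discr_joint_measurable n (j : {ffun 'I_d -> row_quant_index d n}) :
  measurable [set w | [ffun i => row_quant n (xi i w)] = j].
Proof.
rewrite (_ : [set w | _] = \bigcap_(i in [set: 'I_d])
    [set w | row_quant n (xi i w) = j i]).
  by apply: fin_bigcap_measurable => // i _; exact: discr_measurable.
apply/seteqP; split=> w /=.
  by move=> <- i _ /=; rewrite ffunE.
by move=> h; apply/ffunP => i; rewrite ffunE; exact: h.
Qed.

Lemma integral_discr n i (F : 'rV[R]_d -> R) : (forall x, 0 <= F x) ->
  (\int[P]_w (F (discr n i w))%:E =
   (\sum_(k : row_quant_index d n) F (row_dequant k) * discr_prob i k)%:E)%E.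
Proof.
move=> F0; rewrite (@integral_finite_valued _ _ _ P _ _
  (fun k : row_quant_index d n => F (row_dequant k)) (@discr_measurable n i))//.
Qed.

Lemma integral_discr_joint n (F : ('I_d -> 'rV[R]_d) -> R) :
  (forall x, 0 <= F x) ->
  (\int[P]_w (F (fun i => discr n i w))%:E =
   (\sum_(j : {ffun 'I_d -> row_quant_index d n})
     F (fun i => row_dequant (j i)) * \prod_i discr_prob i (j i))%:E)%E.
Proof.
move=> F0.
transitivity (\int[P]_w (F (fun i => row_dequant
    ([ffun i => row_quant n (xi i w)] i)))%:E)%E.
  apply: eq_integral => w _; congr (F _)%:E.
  by apply/funext => i; rewrite ffunE.
rewrite (@integral_finite_valued _ _ _ P _ _
  (fun j : {ffun 'I_d -> row_quant_index d n} => F (fun i => row_dequant (j i)))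
  (@discr_joint_measurable n))//.
by congr _%:E; apply: eq_bigr => j _; rewrite discr_joint_prob.
Qed.

Lemma integral_discr_prod n (s : 'I_d -> 'I_d) :
  (\int[P]_w (\prod_i `|discr n i w 0 (s i)|)%:E =
   \prod_i \int[P]_w (`|discr n i w 0 (s i)|)%:E)%E.
Proof.
rewrite (integral_discr_joint n (F := fun x => \prod_i `|x i 0 (s i)|)); last first.
  by move=> x; apply: prodr_ge0.
under [RHS]eq_bigr do rewrite (integral_discr n _ (F := fun x => `|x 0 (s _)|))//.
rewrite prodEFin bigA_distr_bigA/=; congr _%:E.
by apply: eq_bigr => j _; rewrite big_split.
Qed.

Lemma discr_norm n i w l : `|discr n i w 0 l| <= `|tnth (xi i w) l|.
Proof. by rewrite row_dequantE dequant_norm. Qed.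

Lemma discr_cvg i w l : discr n i w 0 l @[n --> \oo] --> tnth (xi i w) l.
Proof.
rewrite (_ : (fun n => _) = (fun n => dequant (quant n (tnth (xi i w) l)))).
  exact: dequant_cvg.
by apply/funext => n; rewrite row_dequantE.
Qed.

Lemma discr_coord_measurable n i l : measurable_fun setT (fun w => discr n i w 0 l).
Proof.
move=> _ A mA; rewrite setTI.
rewrite (_ : _ @^-1` _ = \bigcup_(k in [set k : row_quant_index d n | A (row_dequant k 0 l)])
  [set w | row_quant n (xi i w) = k]).
  by apply: fin_bigcup_measurable => // k _; exact: discr_measurable.
apply/seteqP; split=> w /=; first by move=> Aw; exists (row_quant n (xi i w)).
by move=> [k Ak /= E]; rewrite /discr E.
Qed.

Lemma xi_coord_measurable i l : measurable_fun setT (fun w => tnth (xi i w) l).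
Proof. by have /measurable_int/measurable_EFinP := xi_int i l. Qed.

End discretised_vectors.

Section cvg_bigop.
Context {R : realType}.

Lemma cvgn_sum (I : Type) (r : seq I) (u : I -> nat -> R) (l : I -> R) :
  (forall i, u i n @[n --> \oo] --> l i) ->
  \sum_(i <- r) u i n @[n --> \oo] --> \sum_(i <- r) l i.
Proof.
move=> ul; elim: r => [|i r IH].
  rewrite big_nil (_ : (fun n => _) = cst 0); first exact: cvg_cst.
  by apply/funext => n; rewrite big_nil.
rewrite big_cons (_ : (fun n => _) = (fun n => u i n + \sum_(j <- r) u j n)).
  exact: cvgD.
by apply/funext => n; rewrite big_cons.
Qed.

Lemma cvgn_prod (I : Type) (r : seq I) (u : I -> nat -> R) (l : I -> R) :
  (forall i, u i n @[n --> \oo] --> l i) ->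
  \prod_(i <- r) u i n @[n --> \oo] --> \prod_(i <- r) l i.
Proof.
move=> ul; elim: r => [|i r IH].
  rewrite big_nil (_ : (fun n => _) = cst 1); first exact: cvg_cst.
  by apply/funext => n; rewrite big_nil.
rewrite big_cons (_ : (fun n => _) = (fun n => u i n * \prod_(j <- r) u j n)).
  exact: cvgM.
by apply/funext => n; rewrite big_cons.
Qed.

Lemma limn_einf_le (u : (\bar R)^nat) (C : \bar R) :
  (forall n, u n <= C)%E -> (limn_einf u <= C)%E.
Proof.
move=> uC; rewrite limn_einf_lim; apply: lime_le; first exact: is_cvg_einfs.
apply: nearW => n; apply: le_trans (uC n).
by apply: ereal_inf_lbound; exists n => /=.
Qed.

Lemma lee_prod_ge0 (I : Type) (r : seq I) (a b : I -> \bar R) :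
  (forall i, 0 <= a i)%E -> (forall i, a i <= b i)%E ->
  (\prod_(i <- r) a i <= \prod_(i <- r) b i)%E.
Proof.
move=> a0 ab; suff [] : (0 <= \prod_(i <- r) a i <= \prod_(i <- r) b i)%E.
  by move=> /andP[].
apply: (big_rec2 (fun x y => 0 <= x <= y)%E) => [|i x y _ /andP[y0 yx]].
  by rewrite lexx andbT.
by rewrite mule_ge0// lee_pmul.
Qed.

Lemma abs_det_le n (A : 'M[R]_n) :
  `|\det A| <= \sum_(s : 'S_n) \prod_i `|A i (s i)|.
Proof.
rewrite /determinant (le_trans (ler_norm_sum _ _ _))// ler_sum// => s _.
by rewrite normrM normrX normrN normr1 expr1n mul1r normr_prod lexx.
Qed.

End cvg_bigop.

(** * Passage to the limit in the discretisation *)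

Section limit.
Context {R : realType} (disp : measure_display) (Omega : measurableType disp)
  (P : probability Omega R) (d : nat) (xi : 'I_d -> {RV P >-> d.-tuple R}).
Hypothesis xi_indep : mutually_independent xi.
Hypothesis xi_int : forall i l,
  P.-integrable setT (fun w => (tnth (xi i w) l)%:E).

(* Independence is only available for the discretised vectors; Fatou's lemma
   carries the product rule over as an inequality. *)
Lemma integrable_prod_coords (s : 'I_d -> 'I_d) :
  P.-integrable setT (fun w => (\prod_i `|tnth (xi i w) (s i)|)%:E).
Proof.
have int_lt i : (\int[P]_w (`|tnth (xi i w) (s i)|)%:E < +oo)%E.
  by have /integrableP[_] := xi_int i (s i).
apply/integrableP; split.
  apply/measurable_EFinP; apply: measurable_prod => i _.
  by apply: measurableT_comp => //; exact: xi_coord_measurable.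
pose C := (\prod_i \int[P]_w (`|tnth (xi i w) (s i)|)%:E)%E.
have Clt : (C < +oo)%E.
  rewrite /C (eq_bigr (fun i => (fine (\int[P]_w (`|tnth (xi i w) (s i)|)%:E))%:E)).
    by rewrite prodEFin ltry.
  by move=> i _; rewrite fineK// ge0_fin_numE// integral_ge0.
apply: le_lt_trans Clt.
pose f n w := (\prod_i `|discr xi n i w 0 (s i)|)%:E.
rewrite (eq_integral (fun w => limn_einf (f^~ w))); last first.
  move=> w _; rewrite gee0_abs ?lee_fin ?prodr_ge0//.
  symmetry; apply: (cvg_limn_einf_sup _).1; apply: cvg_EFin; first exact: nearW.
  apply: cvgn_prod => i.
  by apply: cvg_norm; exact: discr_cvg.
apply: (le_trans (fatou P measurableT _ _)).
- move=> n; apply/measurable_EFinP; apply: measurable_prod => i _.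
  by apply: measurableT_comp => //; exact: discr_coord_measurable.
- by move=> n w _; rewrite lee_fin prodr_ge0.
apply: limn_einf_le => n; rewrite integral_discr_prod//.
apply: lee_prod_ge0 => i; first exact: integral_ge0.
apply: ge0_le_integral => //.
- by apply/measurable_EFinP; apply: measurableT_comp => //; exact: discr_coord_measurable.
- by apply/measurable_EFinP; apply: measurableT_comp => //; exact: xi_coord_measurable.
- by move=> w _; rewrite lee_fin discr_norm.
Qed.

Lemma measurable_absdet (X : Omega -> 'I_d -> 'rV[R]_d) :
  (forall i l, measurable_fun setT (fun w => X w i 0 l)) ->
  measurable_fun setT (fun w => `|\det (\matrix_i X w i)|).
Proof.
move=> mX; apply: measurableT_comp => //.
apply: measurable_sum => s; apply: measurable_funM => //.
apply: measurable_prod => i _.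
rewrite (_ : (fun w => _) = (fun w => X w i 0 (s i)))//.
by apply/funext => w; rewrite mxE.
Qed.

(** Dominated convergence. The majorant comes from the triangle inequality in the Leibniz formula;
    it serves all [n], as rounding never increases a coordinate in absolute value. *)
Lemma cvg_discr_absdet :
  (\int[P]_w (`|\det (\matrix_i discr xi n i w)|)%:E)%E @[n --> \oo] -->
  (\int[P]_w (`|\det (\matrix_i row_of_tuple (xi i w))|)%:E)%E.
Proof.
have [] := @dominated_convergence _ _ _ P setT measurableT
  (fun n w => (`|\det (\matrix_i discr xi n i w)|)%:E)
  (fun w => (`|\det (\matrix_i row_of_tuple (xi i w))|)%:E)
  (fun w => \sum_(s : 'S_d) (\prod_i `|tnth (xi i w) (s i)|)%:E)%E.
- move=> n; apply/measurable_EFinP; apply: measurable_absdet => i l.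
  exact: discr_coord_measurable.
- apply/measurable_EFinP; apply: measurable_absdet => i l.
  rewrite (_ : (fun w => _) = (fun w => tnth (xi i w) l)).
    exact: xi_coord_measurable.
  by apply/funext => w; rewrite mxE.
- apply: aeW => w _; apply: cvg_EFin; first exact: nearW.
  apply: cvg_norm; apply: cvgn_sum => s; apply: cvgM; first exact: cvg_cst.
  apply: cvgn_prod => i; rewrite !mxE.
  rewrite (_ : (fun n => _) = (fun n => discr xi n i w 0 (s i))).
    exact: discr_cvg.
  by apply/funext => n; rewrite mxE.
- apply: integrable_sum => // s _; exact: integrable_prod_coords.
- apply: aeW => w n _; rewrite sumEFin gee0_abs ?lee_fin//.
  apply: (le_trans (abs_det_le _)); apply: ler_sum => s _.
  apply: ler_prod => i _; rewrite normr_ge0 mxE/=; exact: discr_norm.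
by [].
Qed.

Lemma cvg_discr_L1 i l :
  (\int[P]_w (`|discr xi n i w 0 l - tnth (xi i w) l|)%:E)%E @[n --> \oo] -->
  (0 : \bar R).
Proof.
have [] := @dominated_convergence _ _ _ P setT measurableT
  (fun n w => (discr xi n i w 0 l)%:E) (fun w => (tnth (xi i w) l)%:E)
  (fun w => (`|tnth (xi i w) l|)%:E).
- by move=> n; apply/measurable_EFinP; exact: discr_coord_measurable.
- by apply/measurable_EFinP; exact: xi_coord_measurable.
- apply: aeW => w _; apply: cvg_EFin; first exact: nearW.
  exact: discr_cvg.
- by have := integrable_abse (xi_int i l).
- by apply: aeW => w n _; rewrite lee_fin discr_norm.
by [].
Qed.

End limit.

(** * Zonotopes close to an ellipsoid *)

Section dot_product.
Context {R : realType} (n : nat).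
Implicit Types (u v x y z : 'rV[R]_n) (A : set 'rV[R]_n).

Definition dot u z : R := (u *m z^T) 0 0.

Lemma dotE u z : dot u z = \sum_l u 0 l * z 0 l.
Proof. by rewrite /dot mxE; apply: eq_bigr => l _; rewrite mxE. Qed.

Lemma dotDr u y z : dot u (y + z) = dot u y + dot u z.
Proof. by rewrite /dot linearD mulmxDr mxE. Qed.

Lemma dotZr u c z : dot u (c *: z) = c * dot u z.
Proof. by rewrite /dot linearZ/= -scalemxAr mxE. Qed.

Lemma dotBr u y z : dot u (y - z) = dot u y - dot u z.
Proof. by rewrite dotDr -scaleN1r dotZr mulN1r. Qed.

Lemma dot_sumr u (T : finType) (F : T -> 'rV[R]_n) :
  dot u (\sum_k F k) = \sum_k dot u (F k).
Proof. by rewrite /dot linear_sum/= mulmx_sumr summxE. Qed.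

Lemma dotC u z : dot u z = dot z u.
Proof. by rewrite !dotE; apply: eq_bigr => l _; rewrite mulrC. Qed.

Lemma dotBB u z c :
  dot (u - c *: z) (u - c *: z) = dot u u - 2 * c * dot u z + c ^+ 2 * dot z z.
Proof.
rewrite dotBr dotZr ![dot (_ - _) _]dotC !dotBr !dotZr [dot z u]dotC.
by ring.
Qed.

Lemma dot_ge0 u : 0 <= dot u u.
Proof. by rewrite dotE sumr_ge0// => l _; rewrite -expr2 sqr_ge0. Qed.

Lemma dot_eq0 u : dot u u = 0 -> u = 0.
Proof.
rewrite dotE => /eqP; rewrite psumr_eq0 => [/allP h|l _]; last first.
  by rewrite -expr2 sqr_ge0.
apply/rowP => l; have := h l (mem_index_enum l).
by rewrite /= mulf_eq0 orbb mxE => /eqP.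
Qed.

(** Take [u = x - y] with [y] a point of [A] nearest to [x]. If some [z] in [A] had
    [dot u (z - y) > 0], moving from [y] towards [z] would come closer to [x]. *)
Lemma separation A x : A !=set0 -> compact A -> convex_rows A -> ~ A x ->
  exists u, forall z, A z -> dot u z < dot u x.
Proof.
move=> A0 cA vA nAx.
pose f z := dot (x - z) (x - z).
have cf : continuous f.
  rewrite (_ : f = fun z => \sum_l (x 0 l - z 0 l) * (x 0 l - z 0 l)); last first.
    by apply/funext => z; rewrite /f dotE; apply: eq_bigr => l _; rewrite !mxE.
  have cterm l : continuous (fun z : 'rV[R]_n => (x 0 l - z 0 l) * (x 0 l - z 0 l)).
    by apply: continuous_mul; apply: continuous_sub;
      by [exact: cst_continuous|exact: coord_continuous].
  have -> : (fun z : 'rV[R]_n => \sum_l (x 0 l - z 0 l) * (x 0 l - z 0 l)) =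
     (fun z => \sum_(l <- index_enum 'I_n) (x 0 l - z 0 l) * (x 0 l - z 0 l)) by [].
  elim: (index_enum _) => [|l r IH].
    rewrite (_ : (fun z => _) = cst 0); first exact: cst_continuous.
    by apply/funext => z; rewrite big_nil.
  rewrite (_ : (fun z => _) = (fun z : 'rV[R]_n => (x 0 l - z 0 l) * (x 0 l - z 0 l) +
      \sum_(l <- r) (x 0 l - z 0 l) * (x 0 l - z 0 l))).
    exact: continuous_add.
  by apply/funext => z; rewrite big_cons.
have [y /[!inE] Ay ymin] := compact_EVT_min A0 cA (continuous_subspaceT cf).
exists (x - y) => z Az.
have u0 : 0 < dot (x - y) (x - y).
  rewrite lt_neqAle dot_ge0 andbT; apply/eqP => /esym/dot_eq0/eqP.
  by rewrite subr_eq0 => /eqP E; apply: nAx; rewrite E.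
have key : dot (x - y) (z - y) <= 0.
  rewrite leNgt; apply/negP => D0.
  set D := dot (x - y) (z - y) in D0; set N := dot (z - y) (z - y).
  have N0 : 0 <= N := dot_ge0 _.
  have ND : 0 < N + D by rewrite ltr_wpDl.
  (* A step length that is at most 1 and short enough: the squared distance changes by
     [- 2 t D + t^2 N = - t D - t^2 D < 0]. *)
  pose t := D / (N + D).
  have t01 : 0 < t <= 1.
    by rewrite divr_gt0//= ler_pdivrMr// mul1r lerDr.
  have := ymin (t *: z + (1 - t) *: y).
  rewrite inE => /(_ (vA _ _ t Az Ay _)); rewrite (ltW (andP t01).1) (andP t01).2.
  move=> /(_ isT).
  rewrite /f (_ : x - (t *: z + _) = (x - y) - t *: (z - y)); last first.
    by apply/rowP => l; rewrite !mxE; ring.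
  rewrite dotBB -/D -/N.
  have tE : t * N = D - t * D by rewrite /t; field; rewrite gt_eqF.
  have /andP[t0 _] := t01.
  have tD : 0 < t * D by rewrite mulr_gt0.
  have ttD : 0 < t * (t * D) by rewrite mulr_gt0.
  rewrite (_ : t ^+ 2 * N = t * (t * N)); last by rewrite expr2 mulrA.
  by rewrite tE mulrBr => h; lra.
move=> /=; rewrite -subr_gt0 -dotBr (_ : x - z = (x - y) - (z - y)).
  by rewrite dotBr subr_gt0; exact: le_lt_trans key u0.
by apply/rowP => l; rewrite !mxE; ring.
Qed.

End dot_product.

Section quadratic_form.
Context {R : realType} (n : nat) (S : 'M[R]_n).
Implicit Types u v x z : 'rV[R]_n.

Definition qform u v : R := (u *m S *m v^T) 0 0.

Hypothesis S_sym : S^T = S.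
Hypothesis S_unit : S \in unitmx.
Hypothesis qform_ge0 : forall u, 0 <= qform u u.

Lemma qformC u v : qform u v = qform v u.
Proof.
rewrite /qform -[in RHS](trmxK (v *m S *m u^T)) [RHS]mxE.
by rewrite !trmx_mul !trmxK S_sym mulmxA.
Qed.

Lemma qformDr u v w : qform u (v + w) = qform u v + qform u w.
Proof. by rewrite /qform linearD mulmxDr mxE. Qed.

Lemma qformZr u c v : qform u (c *: v) = c * qform u v.
Proof. by rewrite /qform linearZ/= -scalemxAr mxE. Qed.

Lemma qform_expand u v a b : qform (a *: u + b *: v) (a *: u + b *: v) =
  a ^+ 2 * qform u u + 2 * a * b * qform u v + b ^+ 2 * qform v v.
Proof.
rewrite qformDr !qformZr ![qform (_ + _) _]qformC !qformDr !qformZr.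
by rewrite [qform v u]qformC; ring.
Qed.

Lemma qform_CS u v : qform u v ^+ 2 <= qform u u * qform v v.
Proof.
set B := qform u v; set a := qform u u; set b := qform v v.
have a0 : 0 <= a := qform_ge0 u; have b0 : 0 <= b := qform_ge0 v.
have [bz|bn] := eqVneq b 0.
  have [->|B0] := eqVneq B 0; first by rewrite expr0n bz mulr0.
  (* The coefficient is chosen so that the form takes the value [- a - 2 < 0] if [b = 0] and
     [B != 0]. *)
  have := qform_ge0 (1 *: u + (- (a + 1) / B) *: v).
  rewrite qform_expand -/a -/b -/B bz mulr0 addr0 expr1n mul1r.
  rewrite mulr1 -mulrA divfK// => h; exfalso; lra.
(* The form at this vector is [b (a b - B^2)]. *)
have := qform_ge0 (b *: u + (- B) *: v).
rewrite qform_expand -/a -/b -/B => h.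
have bp : 0 < b by rewrite lt_neqAle eq_sym bn.
rewrite -(ler_pM2l bp); nra.
Qed.

Lemma dot_qform x u : dot u x = qform (x *m invmx S) u.
Proof. by rewrite /qform mulmxKV// dotC. Qed.

Lemma qform_inv x : qform (x *m invmx S) (x *m invmx S) = (x *m invmx S *m x^T) 0 0.
Proof.
rewrite /qform mulmxKV// trmx_mul trmx_inv S_sym.
by rewrite mulmxA.
Qed.

(** Cauchy-Schwarz for the form [S], applied to [u] and the dual vector [x S^-1]. On the ellipsoid
    the first factor is at most 1, so [sqrt (u S u^T)] bounds the support function. *)
Lemma dot_le x u : `|dot u x| <=
  Num.sqrt ((x *m invmx S *m x^T) 0 0) * Num.sqrt (qform u u).
Proof.
rewrite -sqrtr_sqr -sqrtrM -?qform_inv//.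
by rewrite ler_wsqrtr// dot_qform qform_CS.
Qed.

(** [dot_le] at the [l]-th unit vector. It makes coordinatewise errors comparable with
    [sqrt (u S u^T)]. *)
Lemma coord_le (l : 'I_n) u : `|u 0 l| <=
  Num.sqrt (((delta_mx 0 l : 'rV[R]_n) *m invmx S *m (delta_mx 0 l : 'rV[R]_n)^T) 0 0) *
  Num.sqrt (qform u u).
Proof.
have -> : u 0 l = dot u (delta_mx 0 l).
  rewrite dotE (bigD1 l)//= mxE !eqxx mulr1 big1 ?addr0// => k /negbTE kl.
  by rewrite mxE kl andbF mulr0.
exact: dot_le.
Qed.

Section zonotope_ellipsoid.
Variables (T : finType) (v : T -> 'rV[R]_n) (e : R).
(** The sum is the support function at [u] of the zonotope spanned by the [v k], assumed to match
    that of the ellipsoid up to the relative error [e]. *)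
Hypothesis he : forall u,
  `|\sum_k `|dot u (v k)| - Num.sqrt (qform u u)| <= e * Num.sqrt (qform u u).

(** A single direction suffices, [u = z S^-1]: with [q = z S^-1 z^T] both [dot u z] and [u S u^T]
    equal [q], so the bound on the support function reads [q <= (1 + e) sqrt q]. *)
Lemma zonotope_sub_ellipsoid z : 0 <= e ->
  zonotope (map v (enum T)) z -> ellipsoid S ((1 + e)^-1 *: z).
Proof.
move=> e0 /zonotopeP[t t1 zE].
have e1 : 0 < 1 + e by rewrite ltr_wpDr.
rewrite /ellipsoid/= linearZ/= -!scalemxAl -scalemxAr scalerA mxE -expr2 exprVn.
set q := (_ *m z^T) _ _.
have qE : q = qform (z *m invmx S) (z *m invmx S) by rewrite qform_inv.
have q0 : 0 <= q by rewrite qE.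
have h1 : q <= \sum_k `|dot (z *m invmx S) (v k)|.
  rewrite -[q]/(dot (z *m invmx S) z) [X in dot _ X <= _]zE dot_sumr.
  apply: ler_sum => k _; rewrite dotZr (le_trans (ler_norm _))// normrM.
  by rewrite ler_piMl// ler_norml.
have := he (z *m invmx S); rewrite -qE => /(le_trans (ler_norm _)) h2.
have h3 : q <= (1 + e) * Num.sqrt q by rewrite mulrDl mul1r; lra.
rewrite ler_pdivrMl ?exprn_gt0// mulr1.
have [->|qn] := eqVneq q 0; first by rewrite sqr_ge0.
have sq : 0 < Num.sqrt q by rewrite sqrtr_gt0 lt_neqAle eq_sym qn.
have : Num.sqrt q <= 1 + e.
  by rewrite -(ler_pM2r sq) -expr2 sqr_sqrtr.
by move=> h4; rewrite -[q]sqr_sqrtr// lerXn2r// nnegrE ltW.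
Qed.

Lemma ellipsoid_sub_zonotope x : e < 1 ->
  ellipsoid S x -> zonotope (map v (enum T)) ((1 - e) *: x).
Proof.
move=> e1 Ex; apply: contrapT => nZ.
have Z0 : zonotope (map v (enum T)) !=set0 by exists 0; exact: zonotope_nonempty.
have [u hu] := separation Z0 (@zonotope_compact _ _ (map v (enum T)))
  (@zonotope_convex _ _ _) nZ.
(* The point where [dot u] reaches the support function of the zonotope; it contradicts the
   separation. *)
pose z := \sum_k Num.sg (dot u (v k)) *: v k.
have /hu : zonotope (map v (enum T)) z.
  apply/zonotopeP; exists (fun k => Num.sg (dot u (v k))) => // k.
  by rewrite -ler_norml normr_sg; case: (_ != 0).
rewrite dot_sumr.
under eq_bigr do rewrite dotZr -normrEsg.
rewrite ltNge => /negP; apply; rewrite dotZr.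
have := he u; rewrite ler_norml => /andP[h1 _].
have h2 : dot u x <= Num.sqrt (qform u u).
  rewrite (le_trans (ler_norm _))// (le_trans (dot_le _ _))//.
  rewrite ler_piMl// -[leRHS]sqrtr1 ler_wsqrtr//.
have h3 : (1 - e) * dot u x <= (1 - e) * Num.sqrt (qform u u).
  by rewrite ler_wpM2l// subr_ge0 ltW.
by apply: (le_trans h3); rewrite mulrBl mul1r; lra.
Qed.

End zonotope_ellipsoid.

End quadratic_form.

(** * Linear forms of a Gaussian vector *)

Section gaussian_vector_moments.
Context {R : realType} (disp : measure_display) (Omega : measurableType disp)
  (P : probability Omega R) (d : nat) (X : {RV P >-> d.-tuple R}) (S : 'M[R]_d).
Hypothesis X_gauss : gaussian_vector X.
Hypothesis X_centered : centered_vector X.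
Hypothesis X_cov : has_covariance_matrix X S.

Let coord j w := tnth (X w) j.

Let mcoord j : measurable_fun setT (coord j).
Proof.
apply: (@measurableT_comp _ _ _ _ _ _ (fun t : d.-tuple R => tnth t j)).
  exact: measurable_tnth.
exact: measurable_funPT.
Qed.

Definition linear_form (u : 'rV[R]_d) w := dot u (row_of_tuple (X w)).

Lemma linear_formE u w : linear_form u w = \sum_j u 0 j * tnth (X w) j.
Proof. by rewrite /linear_form dotE; apply: eq_bigr => j _; rewrite mxE. Qed.

Lemma linear_form_measurable u : measurable_fun setT (linear_form u).
Proof.
rewrite (_ : linear_form u = fun w => \sum_j u 0 j * coord j w); last first.
  by apply/funext => w; rewrite linear_formE.
by apply: measurable_sum => j; apply: measurable_funM => //; exact: mcoord.
Qed.

(** The parameter [s] is not yet related to [S]; sharing it between both moments lets the second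
    moment identify [|s|] later. The mean is a hypothesis because it is first known only for unit
    vectors, whose case yields the integrability behind linearity in [u]. *)
Let form_moments u : ('E_P[linear_form u] = 0)%E ->
  exists s : R,
   (\int[P]_w (linear_form u w ^+ 2)%:E = (s ^+ 2)%:E)%E /\
   (\int[P]_w (`|linear_form u w|)%:E = (Num.sqrt (2 / pi) * `|s|)%:E)%E.
Proof.
move=> E0; have [m [s law]] := X_gauss (tuple_of_row u).
pose Y : {RV P >-> R} := HB.pack (linear_form u)
  (isMeasurableFun.Build _ _ _ _ _ (@linear_form_measurable u)).
have Ylaw : forall A : set R, measurable A -> P [set w | A (Y w)] = gaussian_law m s A.
  move=> A mA; rewrite -law//; congr (P _); apply/seteqP.
  by split=> w; rewrite /= linear_formE;
    under eq_bigr do rewrite tnth_mktuple.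
by exists s; split; [exact: (gaussian_second_moment Ylaw)|exact: (gaussian_abs_moment Ylaw)].
Qed.

Let coord_form j : linear_form (delta_mx 0 j) = coord j.
Proof.
apply/funext => w; rewrite linear_formE (bigD1 j)//= mxE !eqxx mul1r.
by rewrite big1 ?addr0// => k /negbTE kj; rewrite mxE kj andbF mul0r.
Qed.

Lemma coord_integrable j : P.-integrable setT (fun w => (tnth (X w) j)%:E).
Proof.
have [|s [_ h]] := @form_moments (delta_mx 0 j).
  by rewrite coord_form; exact: X_centered.
apply/integrableP; split; first exact/measurable_EFinP/mcoord.
by rewrite coord_form in h; rewrite h ltry.
Qed.

Let coord_sqr_integrable j : P.-integrable setT (fun w => (coord j w ^+ 2)%:E).
Proof.
have [|s [h _]] := @form_moments (delta_mx 0 j).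
  by rewrite coord_form; exact: X_centered.
apply/integrableP; split.
  by apply/measurable_EFinP; apply: measurable_funX; exact: mcoord.
rewrite coord_form in h.
rewrite (eq_integral (fun w => (coord j w ^+ 2)%:E)) ?h ?ltry// => w _.
by rewrite gee0_abs// lee_fin sqr_ge0.
Qed.

Let coord_mul_integrable j k :
  P.-integrable setT (fun w => (coord j w * coord k w)%:E).
Proof.
apply: (le_integrable measurableT _ _
  (integrableD measurableT (coord_sqr_integrable j) (coord_sqr_integrable k))).
  by apply/measurable_EFinP; apply: measurable_funM; exact: mcoord.
move=> w _; rewrite lee_fin.
rewrite [leRHS]ger0_norm; last by rewrite addr_ge0// sqr_ge0.
rewrite ler_norml; apply/andP; split; nra.
Qed.

Let coord_mul_integral j k : (\int[P]_w (coord j w * coord k w)%:E = (S j k)%:E)%E.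
Proof.
rewrite -X_cov unlock !X_centered unlock.
apply: eq_integral => w _.
by rewrite -[coord j w]subr0 -[coord k w]subr0.
Qed.

Lemma linear_form_mean u : ('E_P[linear_form u] = 0)%E.
Proof.
rewrite unlock (eq_integral (fun w => \sum_j ((u 0 j)%:E * (coord j w)%:E))%E); last first.
  by move=> w _; rewrite linear_formE -sumEFin.
rewrite integral_sum//; last first.
  by move=> j; apply: integrableZl => //; exact: coord_integrable.
apply: big1 => j _; rewrite integralZl//; last exact: coord_integrable.
by have := X_centered j; rewrite unlock => ->; rewrite mule0.
Qed.

Lemma linear_form_second_moment u :
  (\int[P]_w (linear_form u w ^+ 2)%:E = (qform S u u)%:E)%E.
Proof.
rewrite (eq_integral (fun w => \sum_j \sum_k
    ((u 0 j * u 0 k)%:E * (coord j w * coord k w)%:E))%E); last first.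
  move=> w _; rewrite linear_formE expr2 mulr_suml.
  rewrite -sumEFin; apply: eq_bigr => j _.
  rewrite mulr_sumr -sumEFin; apply: eq_bigr => k _.
  by rewrite -EFinM; congr _%:E; rewrite /coord; ring.
have I j k : P.-integrable setT
    (fun w => (u 0 j * u 0 k)%:E * (coord j w * coord k w)%:E)%E.
  by apply: integrableZl => //; exact: coord_mul_integrable.
rewrite integral_sum//; last by move=> j; exact: integrable_sum.
rewrite (eq_bigr (fun j => (\sum_k u 0 j * u 0 k * S j k)%:E)); last first.
  move=> j _; rewrite integral_sum// -sumEFin; apply: eq_bigr => k _.
  by rewrite integralZl// ?coord_mul_integral//; exact: coord_mul_integrable.
rewrite sumEFin; congr _%:E.
rewrite /qform mxE exchange_big/=; apply: eq_bigr => k _.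
rewrite !mxE mulr_suml; apply: eq_bigr => j _; ring.
Qed.

Lemma cov_qform_ge0 u : 0 <= qform S u u.
Proof.
rewrite -lee_fin -linear_form_second_moment integral_ge0// => w _.
by rewrite lee_fin sqr_ge0.
Qed.

Lemma cov_sym : S^T = S.
Proof.
apply/matrixP => j k; rewrite mxE.
have := coord_mul_integral k j; have := coord_mul_integral j k.
under eq_integral do rewrite mulrC.
by move=> -> [].
Qed.

Lemma linear_form_abs_moment u : (\int[P]_w (`|linear_form u w|)%:E =
  (Num.sqrt (2 / pi) * Num.sqrt (qform S u u))%:E)%E.
Proof.
have [s [s2 ->]] := form_moments (linear_form_mean u).
move: s2; rewrite linear_form_second_moment => -[->].
by rewrite sqrtr_sqr.
Qed.

End gaussian_vector_moments.

(** * The mixed volume of the ellipsoids *)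

Section finite_sums.
Context {R : realType}.

Lemma sum_ffun_pair (d : nat) (A B : finType) (F : {ffun 'I_d -> A * B} -> R) :
  \sum_h F h = \sum_(f : {ffun 'I_d -> A}) \sum_(g : {ffun 'I_d -> B})
    F [ffun k => (f k, g k)].
Proof.
rewrite pair_bigA/=.
rewrite (reindex (fun p : {ffun 'I_d -> A} * {ffun 'I_d -> B} =>
  [ffun k => (p.1 k, p.2 k)]))//=.
exists (fun h : {ffun 'I_d -> A * B} =>
    ([ffun k => (h k).1], [ffun k => (h k).2])) => [[f g] _|h _] /=.
  by congr pair; apply/ffunP => k; rewrite !ffunE.
by apply/ffunP => k; rewrite !ffunE /= -surjective_pairing.
Qed.

Lemma det_scale_rows (d : nat) (c : 'I_d -> R) (w : 'I_d -> 'rV[R]_d) :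
  \det (\matrix_k (c k *: w k)) = \prod_k c k * \det (\matrix_k w k).
Proof.
rewrite (_ : \matrix_k _ = diag_mx (\row_k c k) *m (\matrix_k w k)).
  rewrite det_mulmx det_diag; congr (_ * _).
  by apply: eq_bigr => k _; rewrite mxE.
by apply/matrixP => i j; rewrite mul_diag_mx !mxE.
Qed.

End finite_sums.

Section mixed_volume_of_ellipsoids.
Context {R : realType} (disp : measure_display) (Omega : measurableType disp)
  (P : probability Omega R) (d : nat)
  (xi : 'I_d -> {RV P >-> d.-tuple R}) (Sigma : 'I_d -> 'M[R]_d).
Hypothesis xi_indep : mutually_independent xi.
Hypothesis xi_gauss : forall i, gaussian_vector (xi i).
Hypothesis xi_centered : forall i, centered_vector (xi i).
Hypothesis xi_cov : forall i, has_covariance_matrix (xi i) (Sigma i).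
Hypothesis xi_nondeg : forall i, Sigma i \in unitmx.

Let xi_int i l : P.-integrable setT (fun w => (tnth (xi i w) l)%:E).
Proof. exact: coord_integrable. Qed.

Let Sigma_sym i : (Sigma i)^T = Sigma i.
Proof. exact: (cov_sym (X := xi i)). Qed.

Let Sigma_ge0 i u : 0 <= qform (Sigma i) u u.
Proof. exact: (cov_qform_ge0 (X := xi i)). Qed.

Let kappa : R := Num.sqrt (pi / 2).

Let kappa_ge0 : 0 <= kappa. Proof. exact: sqrtr_ge0. Qed.

Let kappaE : kappa * Num.sqrt (2 / pi) = 1.
Proof.
have p0 : 0 < pi :> R by exact: pi_gt0.
rewrite /kappa -sqrtrM ?divr_ge0 ?ltW// (_ : _ * _ = 1) ?sqrtr1//.
by field; lra.
Qed.

(** Weighting each value by its probability makes the support function of the zonotope [Z_i] equal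
    to [kappa] times the mean of [|<u, discr>|]. *)
Definition segment_vector n i (k : row_quant_index d n) : 'rV[R]_d :=
  (kappa * discr_prob xi i k) *: row_dequant k.

Let L1err n i l : R :=
  fine (\int[P]_w (`|discr xi n i w 0 l - tnth (xi i w) l|)%:E).

Let L1errE n i l :
  (\int[P]_w (`|discr xi n i w 0 l - tnth (xi i w) l|)%:E = (L1err n i l)%:E)%E.
Proof.
rewrite fineK// ge0_fin_numE ?integral_ge0//.
apply: (@le_lt_trans _ _ (\int[P]_w (2%:E * (`|tnth (xi i w) l|)%:E))%E).
  apply: ge0_le_integral => //.
  - apply/measurable_EFinP; apply: measurableT_comp => //.
    apply: measurable_funB; first exact: discr_coord_measurable.
    exact: xi_coord_measurable.
  - apply: emeasurable_funM => //; apply/measurable_EFinP.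
    by apply: measurableT_comp => //; exact: xi_coord_measurable.
  - move=> w _; rewrite -EFinM lee_fin (le_trans (ler_normB _ _))//.
    by rewrite mulr2n mulrDl mul1r lerD2r discr_norm.
rewrite ge0_integralZl//; last first.
  by apply/measurable_EFinP; apply: measurableT_comp => //; exact: xi_coord_measurable.
rewrite lte_mul_pinfty//.
by have /integrableP[_] := xi_int i l.
Qed.

Let coef i l : R := Num.sqrt (((delta_mx 0 l : 'rV[R]_d) *m
  invmx (Sigma i) *m (delta_mx 0 l : 'rV[R]_d)^T) 0 0).

(** The constants [coef] are those of [coord_le]. Summing over [i] yields one error valid for all
    the ellipsoids. *)
Let err n : R := kappa * \sum_i \sum_l coef i l * L1err n i l.

Let L1err_ge0 n i l : 0 <= L1err n i l.
Proof. by rewrite fine_ge0// integral_ge0. Qed.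

Let err_ge0 n : 0 <= err n.
Proof.
rewrite mulr_ge0// sumr_ge0// => i _; rewrite sumr_ge0// => l _.
by rewrite mulr_ge0// sqrtr_ge0.
Qed.

Let err_cvg : err n @[n --> \oo] --> 0.
Proof.
have -> : (0 : R) = kappa * \sum_i \sum_l coef i l * 0.
  by rewrite [X in _ * X]big1 ?mulr0// => i _; rewrite big1// => l _; rewrite mulr0.
apply: cvgM; first exact: cvg_cst.
apply: cvgn_sum => i; apply: cvgn_sum => l; apply: cvgM; first exact: cvg_cst.
exact: fine_cvg (cvg_discr_L1 xi_int i l).
Qed.

(** The means [a] and [b] of [|<u, discr>|] and [|<u, xi>|] differ by at most [c], the L1 errors of
    the coordinates weighted by [|u_l|]. Multiplied by [kappa], [b] becomes [q], and [coord_le]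
    bounds [c] by a multiple of [q]. *)
Lemma segment_support n i u :
  `|\sum_k `|dot u (@segment_vector n i k)| -
     Num.sqrt (qform (Sigma i) u u)| <= err n * Num.sqrt (qform (Sigma i) u u).
Proof.
set q := Num.sqrt _; have q0 : 0 <= q by exact: sqrtr_ge0.
pose a := \sum_k `|dot u (row_dequant k)| * discr_prob xi i (n := n) k.
have aE : (\int[P]_w (`|dot u (discr xi n i w)|)%:E = a%:E)%E.
  exact: (@integral_discr _ _ _ P _ xi n i (fun x => `|dot u x|)).
pose b := Num.sqrt (2 / pi) * q.
have bE : (\int[P]_w (`|linear_form (xi i) u w|)%:E = b%:E)%E.
  exact: linear_form_abs_moment.
pose c := \sum_l `|u 0 l| * L1err n i l.
have cE : (\int[P]_w (\sum_l (`|u 0 l|)%:E *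
    (`|discr xi n i w 0 l - tnth (xi i w) l|)%:E) = c%:E)%E.
  have mdiff l : measurable_fun setT
      (fun w => (`|discr xi n i w 0 l - tnth (xi i w) l|)%:E).
    apply/measurable_EFinP; apply: measurableT_comp => //.
    apply: measurable_funB; first exact: discr_coord_measurable.
    exact: xi_coord_measurable.
  rewrite ge0_integral_sum//; last by move=> l; exact: measurable_funeM.
  rewrite -sumEFin; apply: eq_bigr => l _.
  by rewrite ge0_integralZl// L1errE.
have mA : measurable_fun setT (fun w => (`|dot u (discr xi n i w)|)%:E).
  apply/measurable_EFinP; apply: measurableT_comp => //.
  rewrite (_ : (fun w => _) = fun w => \sum_l u 0 l * discr xi n i w 0 l).
    apply: measurable_sum => l; apply: measurable_funM => //.
    exact: discr_coord_measurable.
  by apply/funext => w; rewrite dotE.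
have mB : measurable_fun setT (fun w => (`|linear_form (xi i) u w|)%:E).
  apply/measurable_EFinP; apply: measurableT_comp => //.
  exact: linear_form_measurable.
have mC : measurable_fun setT (fun w => \sum_l (`|u 0 l|)%:E *
    (`|discr xi n i w 0 l - tnth (xi i w) l|)%:E)%E.
  apply: emeasurable_sum => l; apply: measurable_funeM.
  apply/measurable_EFinP; apply: measurableT_comp => //.
  apply: measurable_funB; first exact: discr_coord_measurable.
  exact: xi_coord_measurable.
have C0 w : (0 <= \sum_l (`|u 0 l|)%:E *
    (`|discr xi n i w 0 l - tnth (xi i w) l|)%:E)%E.
  by apply: sume_ge0 => l _; rewrite mule_ge0.
have diff w : `|dot u (discr xi n i w) - linear_form (xi i) u w| <=
    \sum_l `|u 0 l| * `|discr xi n i w 0 l - tnth (xi i w) l|.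
  rewrite /linear_form -dotBr dotE (le_trans (ler_norm_sum _ _ _))//.
  by apply: ler_sum => l _; rewrite normrM !mxE.
have ab : a <= b + c.
  rewrite -lee_fin EFinD -aE -bE -cE -ge0_integralD//.
  apply: ge0_le_integral => //; first exact: emeasurable_funD.
  move=> w _; under eq_bigr do rewrite -EFinM.
  rewrite sumEFin -EFinD lee_fin -lerBlDl (le_trans _ (diff w))//.
  exact: lerB_dist.
have ba : b <= a + c.
  rewrite -lee_fin EFinD -aE -bE -cE -ge0_integralD//.
  apply: ge0_le_integral => //; first exact: emeasurable_funD.
  move=> w _; under eq_bigr do rewrite -EFinM.
  rewrite sumEFin -EFinD lee_fin -lerBlDl (le_trans _ (diff w))//.
  by rewrite distrC; exact: lerB_dist.
have c_le : kappa * c <= err n * q.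
  rewrite /err -mulrA ler_wpM2l// mulr_suml.
  rewrite (bigD1 i)//= -[leLHS]addr0 lerD//; last first.
    rewrite sumr_ge0// => i' _; rewrite mulr_ge0// sumr_ge0// => l _.
    by rewrite mulr_ge0// sqrtr_ge0.
  rewrite /c mulr_suml; apply: ler_sum => l _.
  rewrite mulrAC ler_wpM2r//.
  exact: coord_le.
have -> : \sum_k `|dot u (segment_vector (n := n) i k)| = kappa * a.
  rewrite mulr_sumr; apply: eq_bigr => k _.
  rewrite dotZr normrM ger0_norm; last by rewrite mulr_ge0// discr_prob_ge0.
  by rewrite -mulrA; congr (_ * _); rewrite mulrC.
have -> : q = kappa * b by rewrite mulrA kappaE mul1r.
rewrite -mulrBr normrM ger0_norm// [kappa * b]mulrA kappaE mul1r.
rewrite (le_trans _ c_le)// ler_wpM2l// ler_norml; apply/andP; split; lra.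
Qed.


(* The mixed volume [V_d(Z_(f 0), ..., Z_(f (d-1)))] of the approximating
   zonotopes. *)
Definition discr_mixed_volume n (f : {ffun 'I_d -> 'I_d}) : R :=
  (2 * kappa) ^+ d / d`!%:R *
  \sum_(j : {ffun 'I_d -> row_quant_index d n})
    `|\det (\matrix_k row_dequant (j k))| *
    \prod_k discr_prob xi (f k) (j k).

Lemma discr_mixed_volume_sym n (s : 'S_d) (f : {ffun 'I_d -> 'I_d}) :
  discr_mixed_volume n [ffun k => f (s k)] = discr_mixed_volume n f.
Proof.
congr (_ * _).
rewrite (reindex (fun j : {ffun 'I_d -> row_quant_index d n} =>
  [ffun k => j (s k)]))/=; last first.
  exists (fun j : {ffun 'I_d -> row_quant_index d n} =>
      [ffun k => j ((s^-1)%g k)]) => j _.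
    by apply/ffunP => k; rewrite !ffunE permKV.
  by apply/ffunP => k; rewrite !ffunE permK.
apply: eq_bigr => j _; congr (_ * _).
  rewrite (_ : \matrix_k _ = row_perm s (\matrix_k row_dequant (j k))).
    by rewrite row_permE det_mulmx det_perm normrM normrX normrN normr1 expr1n mul1r.
  by apply/matrixP => k l; rewrite !mxE ffunE.
rewrite [RHS](reindex_inj (@perm_inj _ s)).
by apply: eq_bigr => k _; rewrite !ffunE.
Qed.

Definition discr_volume n (lam : 'I_d -> R) : R :=
  \sum_(f : {ffun 'I_d -> 'I_d}) (\prod_k lam (f k)) * discr_mixed_volume n f.

Lemma discr_volume_scale n c lam :
  discr_volume n (fun i => c * lam i) = c ^+ d * discr_volume n lam.
Proof.
rewrite /discr_volume mulr_sumr; apply: eq_bigr => f _.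
by rewrite big_split/= prodr_const card_ord mulrA.
Qed.

Definition scaled_segments n (lam : 'I_d -> R) : seq 'rV[R]_d :=
  map (fun ik : 'I_d * row_quant_index d n =>
    lam ik.1 *: segment_vector ik.1 ik.2) (enum {: 'I_d * row_quant_index d n}).

(** A [d]-tuple of generators of [\sum_i lam i Z_i] chooses bodies [f] and values [j]; its
    determinant is that of the values times the scalars [lam], [kappa] and the probabilities. *)
Lemma Vol_scaled_segments n lam : (forall i, 0 <= lam i) ->
  Vol (zonotope (scaled_segments n lam)) = (discr_volume n lam)%:E.
Proof.
move=> lam0; rewrite Vol_zonotope_enum sum_ffun_pair; congr _%:E.
rewrite mulr_sumr; apply: eq_bigr => f _.
rewrite /discr_mixed_volume mulrCA exprMn -!mulrA; congr (_ * _).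
rewrite [RHS]mulrCA; congr (_ * _).
rewrite [RHS]mulrA mulr_sumr; apply: eq_bigr => j _.
rewrite (_ : \matrix_k _ = \matrix_k ((lam (f k) * (kappa * discr_prob xi (f k) (j k))) *:
    row_dequant (j k))); last first.
  by apply/row_matrixP => k; rewrite !rowK ffunE /= /segment_vector scalerA.
rewrite det_scale_rows normrM ger0_norm; last first.
  by apply: prodr_ge0 => k _; rewrite !mulr_ge0// discr_prob_ge0.
by rewrite !big_split/= prodr_const card_ord; ring.
Qed.

Let K i := ellipsoid (Sigma i).

(** The error being common to all [i], its factor can be put on [lam], where homogeneity turns it
    into a [d]-th power. *)
Lemma scaled_segments_sub n lam : (forall i, 0 <= lam i) ->
  zonotope (scaled_segments n (fun i => (1 + err n)^-1 * lam i)) `<=`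
  minkowski_comb lam K.
Proof.
move=> lam0 z /zonotopeP[t t1 ->].
exists (fun i => (1 + err n)^-1 *: \sum_k t (i, k) *: segment_vector (n := n) i k).
  move=> i /=; apply: (zonotope_sub_ellipsoid (Sigma_sym i) (xi_nondeg i)
    (Sigma_ge0 i) (@segment_support n i)) => //.
  by apply/zonotopeP; exists (fun k => t (i, k)).
rewrite (eq_bigr (fun i => \sum_k t (i, k) *: ((1 + err n)^-1 * lam i *:
    segment_vector (n := n) i k))).
  by rewrite pair_bigA/=; apply: eq_bigr => -[i k] _.
move=> i _; rewrite !scaler_sumr; apply: eq_bigr => k _.
by rewrite !scalerA; congr (_ *: _); ring.
Qed.

Lemma scaled_segments_sup n lam : err n < 1 ->
  minkowski_comb lam K `<=`
  zonotope (scaled_segments n (fun i => (1 - err n)^-1 * lam i)).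
Proof.
move=> e1 z [x Kx <-].
have /choice[t ht] : forall i, exists t : row_quant_index d n -> R,
    (forall k, -1 <= t k <= 1) /\
    (1 - err n) *: x i = \sum_k t k *: segment_vector (n := n) i k.
  move=> i; have /zonotopeP[t t1 E] : zonotope (map (@segment_vector n i)
      (enum (row_quant_index d n))) ((1 - err n) *: x i).
    apply: (ellipsoid_sub_zonotope (Sigma_sym i) (xi_nondeg i)
      (Sigma_ge0 i) (@segment_support n i)) => //.
    exact: Kx.
  by exists t.
apply/zonotopeP; exists (fun ik => t ik.1 ik.2) => [[i k]|]; first exact: (ht i).1.
transitivity (\sum_i \sum_k t i k *: ((1 - err n)^-1 * lam i *:
    segment_vector (n := n) i k)); last first.
  by rewrite pair_bigA/=; apply: eq_bigr => -[i k] _.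
apply: eq_bigr => i _.
have e0 : 1 - err n != 0 by rewrite gt_eqF// subr_gt0.
have -> : x i = (1 - err n)^-1 *: \sum_k t i k *: segment_vector (n := n) i k.
  by rewrite -(ht i).2 scalerA mulVf// scale1r.
rewrite !scaler_sumr; apply: eq_bigr => k _.
by rewrite !scalerA; congr (_ *: _); ring.
Qed.

Lemma Vol_minkowski_lower n lam : (forall i, 0 <= lam i) ->
  (((1 + err n)^-1 ^+ d * discr_volume n lam)%:E <= Vol (minkowski_comb lam K))%E.
Proof.
move=> lam0; rewrite -discr_volume_scale -Vol_scaled_segments.
  by apply: Vol_le; exact: scaled_segments_sub.
by move=> i; rewrite mulr_ge0// invr_ge0 addr_ge0.
Qed.

Lemma Vol_minkowski_upper n lam : (forall i, 0 <= lam i) -> err n < 1 ->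
  (Vol (minkowski_comb lam K) <= ((1 - err n)^-1 ^+ d * discr_volume n lam)%:E)%E.
Proof.
move=> lam0 e1; rewrite -discr_volume_scale -Vol_scaled_segments.
  by apply: Vol_le; exact: scaled_segments_sup.
by move=> i; rewrite mulr_ge0// invr_ge0 subr_ge0 ltW.
Qed.

Let err_lt1 : \forall n \near \oo, err n < 1.
Proof. exact: (cvgr_lt 0 err_cvg). Qed.

Let VK lam : R := fine (Vol (minkowski_comb lam K)).

Let VKE lam : (forall i, 0 <= lam i) -> Vol (minkowski_comb lam K) = (VK lam)%:E.
Proof.
move=> lam0; rewrite fineK// ge0_fin_numE ?Vol_ge0//.
(* One approximation with [err n < 1] encloses the body in a zonotope, so [fine] does not fall back
   on its default value. *)
have [n en] := filter_ex err_lt1.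
by rewrite (le_lt_trans (Vol_minkowski_upper lam0 en))// ltry.
Qed.

(** The two volume bounds are solved for [discr_volume n lam], which leaves the fixed [VK lam] on
    both sides with factors tending to 1. *)
Lemma discr_volume_cvg lam : (forall i, 0 <= lam i) ->
  discr_volume n lam @[n --> \oo] --> VK lam.
Proof.
move=> lam0.
apply: (@squeeze_cvgr _ _ _ _ (fun n => (1 - err n) ^+ d * VK lam)
   (fun n => (1 + err n) ^+ d * VK lam)).
- apply: filterS err_lt1 => n en; apply/andP; split.
    have := Vol_minkowski_upper lam0 en; rewrite VKE// lee_fin.
    by rewrite exprVn ler_pdivlMl// exprn_gt0// subr_gt0.
  have := Vol_minkowski_lower n lam0; rewrite VKE// lee_fin.
  by rewrite exprVn ler_pdivrMl// exprn_gt0// ltr_wpDr.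
- rewrite -[X in _ --> X]mul1r -{2}(expr1n _ d) -{2}[1](subr0 1).
  apply: cvgM; last exact: cvg_cst.
  apply: (cvg_comp (fun n => 1 - err n) (fun x => x ^+ d)); last exact: exprn_continuous.
  by apply: cvgB; [exact: cvg_cst|exact: err_cvg].
- rewrite -[X in _ --> X]mul1r -{2}(expr1n _ d) -{2}[1](addr0 1).
  apply: cvgM; last exact: cvg_cst.
  apply: (cvg_comp (fun n => 1 + err n) (fun x => x ^+ d)); last exact: exprn_continuous.
  by apply: cvgD; [exact: cvg_cst|exact: err_cvg].
Qed.

Lemma discr_mixed_volume_cvg f :
  discr_mixed_volume n f @[n --> \oo] --> polarize VK f.
Proof.
rewrite (_ : (fun n => _) = (fun n => polarize (discr_volume n) f)); last first.
  apply/funext => n; apply: polarizeP; first exact: discr_mixed_volume_sym.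
  by [].
apply: cvgM; first exact: cvg_cst.
apply: cvgn_sum => A; apply: cvgM; first exact: cvg_cst.
by apply: discr_volume_cvg => i; exact: sumr_ge0.
Qed.

(** Symmetry and the volume identity hold for each zonotope approximation and are preserved by
    pointwise limits. *)
Lemma ellipsoid_mixed_volume_coefs : mixed_volume_coefs K (polarize VK).
Proof.
split=> [s f|lam lam0].
  apply: (cvg_unique _ (discr_mixed_volume_cvg (f := _)) _) => //.
  rewrite (_ : (fun n => _) = (fun n => discr_mixed_volume n f)).
    exact: discr_mixed_volume_cvg.
  by apply/funext => n; exact: discr_mixed_volume_sym.
rewrite VKE//; congr _%:E; apply: (cvg_unique _ (discr_volume_cvg lam0)) => //.
apply: cvgn_sum => f; apply: cvgM; first exact: cvg_cst.
exact: discr_mixed_volume_cvg.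
Qed.

(** [xget] is determined only if a value exists and is unique; uniqueness is [polarizeP] applied to
    any other coefficients. *)
Lemma ellipsoid_mixed_volumeE : mixed_volume K = polarize VK [ffun i => i].
Proof.
apply: xget_unique.
  by exists (polarize VK) => //; exact: ellipsoid_mixed_volume_coefs.
move=> v [V [Vsym VE] ->]; apply: polarizeP => // lam lam0.
by apply: EFin_inj; rewrite -VKE// VE.
Qed.

(** For each [n] the identity is exact between the discretised mean and [discr_mixed_volume]; it
    remains to pass to the limit on both sides. *)
Lemma expected_absdet :
  (\int[P]_w (`|\det (\matrix_i row_of_tuple (xi i w))|)%:E =
   (d`!%:R / (2 * kappa) ^+ d * mixed_volume K)%:E)%E.
Proof.
have k0 : (2 * kappa) ^+ d != 0.
  rewrite expf_neq0// mulf_neq0//; apply/eqP => k0.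
  by have := kappaE; rewrite k0 mul0r => /eqP; rewrite eq_sym oner_eq0.
have f0 : d`!%:R != 0 :> R by rewrite pnatr_eq0 -lt0n fact_gt0.
apply: (cvg_unique _ (cvg_discr_absdet xi_indep xi_int)) => //.
rewrite (_ : (fun n => _) = (fun n => (d`!%:R / (2 * kappa) ^+ d *
    discr_mixed_volume n [ffun i => i])%:E)); last first.
  apply/funext => n.
  rewrite (@integral_discr_joint _ _ _ P _ xi xi_indep n
    (fun x => `|\det (\matrix_i x i)|))//; congr _%:E.
  rewrite /discr_mixed_volume mulrA (_ : d`!%:R / _ * _ = 1).
    rewrite mul1r; apply: eq_bigr => j _; congr (_ * _).
    by apply: eq_bigr => i _; rewrite ffunE.
  by rewrite mulf_div [X in _ / X]mulrC divff// mulf_neq0.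
apply: cvg_EFin; first exact: nearW.
apply: cvgM; first exact: cvg_cst.
rewrite ellipsoid_mixed_volumeE; exact: discr_mixed_volume_cvg.
Qed.

End mixed_volume_of_ellipsoids.

Theorem corollary1p2 (R : realType) (disp : measure_display)
    (Omega : measurableType disp) (P : probability Omega R)
    (d : nat) (hd : (1 <= d)%N)
    (xi : 'I_d -> {RV P >-> d.-tuple R}) (Sigma : 'I_d -> 'M[R]_d)
    (xi_indep : mutually_independent xi)
    (xi_gauss : forall i, gaussian_vector (xi i))
    (xi_centered : forall i, centered_vector (xi i))
    (xi_cov : forall i, has_covariance_matrix (xi i) (Sigma i))
    (xi_nondeg : forall i, Sigma i \in unitmx) :
  ('E_P[fun w => `| \det (\matrix_(i < d) row_of_tuple (xi i w)) |%R])%E =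
  (d`!%:R / ((2 * pi) `^ (d%:R / 2)) *
     mixed_volume (fun i => ellipsoid (Sigma i)))%:E.
Proof.
rewrite unlock (expected_absdet xi_indep xi_gauss xi_centered xi_cov xi_nondeg).
congr (_ / _ * _)%:E.
have p0 : 0 < pi :> R by exact: pi_gt0.
(* The factor 2 enters the root as 4, so [2 kappa = sqrt (2 pi)]. *)
have -> : 2 * Num.sqrt (pi / 2) = (2 * pi) `^ 2^-1 :> R.
  rewrite powR12_sqrt ?mulr_ge0 ?ltW//.
  rewrite -[X in X * _](normr_nat R 2) -sqrtr_sqr -sqrtrM ?sqr_ge0//.
  by congr Num.sqrt; field.
by rewrite -powR_mulrn ?powR_ge0// -powRrM [2^-1 * _]mulrC.
Qed.
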